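(* Let $(V,E,\mathbf{w})$ be a connected weighted graph, where $E=\{e_1,e_2,\dots,e_m\}$ is the set of all edges, $\mathbf{w}=(w_{e_1},\dots,w_{e_m})$, and $w_{e_i}$ is the weight of the edge $e_i$, $i=1,\dots,m$. Then for any initial weight $\mathbf{w}_0=(w_{0,1},\dots,w_{0,m})\in\mathbb{R}^m_+$, the quasi-normalized Ricci flow $$\begin{cases}\dfrac{d}{dt}w_{e_i}(t)=-\kappa_{e_i}(t)\rho_{e_i}(t)+\dfrac{\sum_{\tau\in E}\kappa_\tau(t)\rho_\tau(t)}{\sum_{h\in E}w_h(t)}\,\rho_{e_i}(t)\\[1.5ex] w_{e_i}(0)=w_{0,i}\end{cases}\qquad i=1,2,\dots,m,$$ has a unique solution $\mathbf{w}(t)=(w_{e_1}(t),\dots,w_{e_m}(t))\in\mathbb{R}^m_+$ for all $t\in[0,+\infty)$. Here $\kappa_e$ is the Lin-Lu-Yau Ricci curvature of the edge $e$ and $\rho_e$ is the weighted graph distance between the endpoints of $e$.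
   Context: $\mathbb{R}^m_+=\{(w_1,\dots,w_m)\in\mathbb{R}^m: w_i>0,\ i=1,\dots,m\}$. The graph $(V,E)$ is finite and undirected; each edge $e=xy$ is an unordered pair of distinct vertices, and $z\sim u$ means $zu\in E$. A weight is a vector $\mathbf{w}=(w_{e_1},\dots,w_{e_m})\in\mathbb{R}^m_+$ assigning $w_{e_i}>0$ to the edge $e_i$; we write $w_{xy}=w_e$ if $e=xy$. For $u,v\in V$, the distance is $d(u,v)=\inf_\gamma\sum_{e\in\gamma}w_e$, the infimum over all paths $\gamma$ connecting $u$ and $v$ (so $d(u,u)=0$). For $e=xy\in E$ write $\rho_e=d(x,y)$. For $\alpha\in[0,1]$ and $u\in V$, $\mu_u^\alpha$ is the probability measure on $V$ given by $\mu_u^\alpha(u)=\alpha$, $\mu_u^\alpha(z)=(1-\alpha)\frac{w_{zu}}{\sum_{y\sim u}w_{yu}}$ if $z\sim u$, and $\mu_u^\alpha(z)=0$ otherwise. $W(\mu,\nu)$ is the usual transportation distance between probability measures on $V$: $W(\mu,\nu)=\inf_A\sum_{u,v\in V}A(u,v)d(u,v)$ over all couplings $A:V\times V\to[0,1]$ with $\sum_vA(u,v)=\mu(u)$ and $\sum_uA(u,v)=\nu(v)$. The Lin-Lu-Yau Ricci curvature is, for distinct $u,v\in V$, $$\kappa(u,v)=\lim_{\alpha\to1}\frac{1}{1-\alpha}\left[1-\frac{W(\mu_u^\alpha,\mu_v^\alpha)}{d(u,v)}\right],$$ the limit being taken as $\alpha\to 1$ with $\alpha<1$ (it is known to exist).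 For $e=xy\in E$ write $\kappa_e=\kappa(x,y)$. All of $d,\rho_e,\kappa_e$ depend on the weight $\mathbf{w}$; $\rho_e(t)$ and $\kappa_e(t)$ denote these quantities computed from $\mathbf{w}(t)$. A solution on an interval is a differentiable function of $t$ with values in $\mathbb{R}^m_+$ satisfying the system there. *)

(* Defs.v *)
From mathcomp Require Import all_boot all_order all_algebra.
From mathcomp Require Import all_classical all_reals all_analysis.

Set Implicit Arguments.
Unset Strict Implicit.
Unset Printing Implicit Defensive.

Import Order.TTheory GRing.Theory Num.Theory.
Import numFieldNormedType.Exports.

Local Open Scope classical_set_scope.
Local Open Scope ring_scope.

(* A finite simple undirected graph on V with edges e_0, ..., e_{m-1}.  The
   edge e_i is the unordered pair of the two components of [ends i]; the order
   in which the two endpoints are stored is immaterial, since adjacency,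
   weights, distance and curvature below do not depend on it. *)
Record graph (V : finType) (m : nat) := Graph {
  ends : 'I_m -> V * V;
  ends_neq : forall i, (ends i).1 != (ends i).2;
  ends_inj : injective (fun i => [set (ends i).1; (ends i).2]%SET)
}.

Section WeightedGraph.
Variables (R : realType) (V : finType) (m : nat) (G : graph V m).

Definition edge (i : 'I_m) : {set V} := [set (ends G i).1; (ends G i).2]%SET.

Definition adj : rel V := fun x y => [exists i, edge i == [set x; y]%SET].

Definition connected_graph : Prop := forall x y, connect adj x y.

Implicit Types (w : 'rV[R]_m) (u v x y z : V).

Definition positive_weight w : Prop := forall i, 0 < w 0 i.

(* At most one i contributes, by [ends_inj]; the value is 0 when x and y are
   not adjacent. *)
Definition weight w x y : R := \sum_(i | edge i == [set x; y]%SET) w 0 i.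

(* The length of the path u :: p. *)
Definition path_length w u (p : seq V) : R := \sum_(l <- pairmap (weight w) u p) l.

Definition dist w u v : R :=
  inf [set path_length w u p | p in [set p | path adj u p /\ last u p = v]].

Definition mu w (a : R) u : V -> R := fun z =>
  if z == u then a
  else if adj z u then (1 - a) * (weight w z u / \sum_(y | adj y u) weight w y u)
  else 0.

Definition coupling (m1 m2 : V -> R) : set (V -> V -> R) :=
  [set A | [/\ forall u v, 0 <= A u v <= 1,
               forall u, \sum_v A u v = m1 u
             & forall v, \sum_u A u v = m2 v]].

Definition transport w (m1 m2 : V -> R) : R :=
  inf [set \sum_u \sum_v A u v * dist w u v | A in coupling m1 m2].

Definition curvature w u v : R :=
  lim ((1 - a)^-1 * (1 - transport w (mu w a u) (mu w a v) / dist w u v)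
       @[a --> 1^'-]).

Definition rho w (i : 'I_m) : R := dist w (ends G i).1 (ends G i).2.

Definition kappa w (i : 'I_m) : R := curvature w (ends G i).1 (ends G i).2.

Definition flow_rhs w (i : 'I_m) : R :=
  - kappa w i * rho w i
  + (\sum_j kappa w j * rho w j) / (\sum_j w 0 j) * rho w i.

(* f has derivative l at t relative to the interval D: two-sided at interior
   points of D, one-sided at endpoints belonging to D. *)
Definition has_deriv_in (D : set R) (f : R -> R) (t l : R) : Prop :=
  (f s - f t) / (s - t) @[s --> within D t^'] --> l.

Definition flow_solution (D : set R) (w0 : 'rV[R]_m) (w : R -> 'rV[R]_m) : Prop :=
  [/\ forall t, D t -> positive_weight (w t),
      forall t, D t -> forall i,
        has_deriv_in D (fun s => w s 0 i) t (flow_rhs (w t) i)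
    & w 0 = w0].

End WeightedGraph.

(* Main.v *)
Require Import Defs.
From mathcomp Require Import all_boot all_order all_algebra.
From mathcomp Require Import all_classical all_reals all_analysis.
From mathcomp Require Import ring lra.
Set Implicit Arguments.
Unset Strict Implicit.
Unset Printing Implicit Defensive.
Import Order.TTheory GRing.Theory Num.Theory.
Import numFieldNormedType.Exports.
Local Open Scope classical_set_scope.
Local Open Scope ring_scope.

(* Let d = rho_e for an edge e = xy and let W_a be the transport distance at
   idleness a.  For a in [1/2, 1) the optimal plans differ only by a rescaling
   of all their mass but the entry (x, y), so (d - W_a) / (1 - a) does not depend
   on a and kappa_e rho_e = 2 (d - W_(1/2)).  As W_(1/2) is locally Lipschitz in
   the weight, so is the vector field F of the flow; moreover F_e >= - b w_e and
   F_e <= b max w for a constant b, so that solutions stay in the growing box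
   1/E(t) <= w_e <= E(t) with E(t) = E_0 exp(b t).  Clamping the argument of F to
   this box yields a field with a time-dependent global Lipschitz constant, to
   which Picard iteration applies; its solution never leaves the box, hence
   solves the flow, and every solution of the flow solves the clamped system. *)

(** * Curves on the half-line *)

(** The field is Lipschitz only locally, with constants that blow up as a weight tends to 0 or to
    infinity, and the curvature by itself is a quotient by a distance. The flow contains curvature
    only through the products kappa_e rho_e, where this quotient cancels. Regularity of W_(1/2) is
    obtained from ratios rather than differences: weights that agree up to a factor c have distances
    that agree up to c and transition probabilities that agree up to c^2, and on a box of size E an
    additive error d amounts to a factor 1 + E d. The constant b comes from two bounds. W_(1/2) >= 0
    gives kappa_e rho_e <= 2 rho_e <= 2 w_e, and W_(1/2) <= |V| sum w gives kappa_e rho_e >= - 2 |V|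
    sum w. Hence the normalising factor lies between - 2 |V| m and 2, every negative contribution to
    F_e is a multiple of rho_e <= w_e, and growth is controlled by the total weight only. *)

Section Curves.
Variable R : realType.
Implicit Types (f g h : R -> R).

(** The derivative is asked only at positive times because a solution of the flow has just a
    one-sided derivative at 0. Continuity across 0 is enough for the mean value theorem on intervals
    starting at 0. *)
Definition derives_to f f' : Prop :=
  continuous f /\ forall t : R, 0 < t -> is_derive t 1 f (f' t).

Lemma derives_toD f f' g g' : derives_to f f' -> derives_to g g' ->
  derives_to (fun t => f t + g t) (fun t => f' t + g' t).
Proof.
move=> [cf df] [cg dg]; split=> [t|t t0].
  by apply: cvgD; [exact: cf|exact: cg].
by apply: is_deriveD; [exact: df|exact: dg].
Qed.

Lemma derives_toN f f' : derives_to f f' ->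
  derives_to (fun t => - f t) (fun t => - f' t).
Proof.
move=> [cf df]; split=> [t|t t0]; first by apply: cvgN; exact: cf.
by apply: is_deriveN; exact: df.
Qed.

Lemma derives_toM f f' g g' : derives_to f f' -> derives_to g g' ->
  derives_to (fun t => f t * g t) (fun t => f t * g' t + g t * f' t).
Proof.
move=> [cf df] [cg dg]; split=> [t|t t0].
  by apply: cvgM; [exact: cf|exact: cg].
by apply: is_deriveM; [exact: df|exact: dg].
Qed.

Lemma derives_to_cst (c : R) : derives_to (fun=> c) (fun=> 0).
Proof. by split=> [t|t _]; [exact: cvg_cst|exact: is_derive_cst]. Qed.

Lemma derives_to_sum (I : finType) (f f' : I -> R -> R) :
  (forall i, derives_to (f i) (f' i)) ->
  derives_to (fun t => \sum_i f i t) (fun t => \sum_i f' i t).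
Proof.
move=> df; have [s ->] : exists s, index_enum I = s by exists (index_enum I).
elim: s => [|i s IH].
  have -> : (fun t => \sum_(i <- [::]) f i t) = fun=> 0.
    by apply/funext => t; rewrite big_nil.
  have -> : (fun t => \sum_(i <- [::]) f' i t) = fun=> 0.
    by apply/funext => t; rewrite big_nil.
  exact: derives_to_cst.
have -> : (fun t => \sum_(i <- i :: s) f i t) =
    fun t => f i t + \sum_(i <- s) f i t.
  by apply/funext => t; rewrite big_cons.
have -> : (fun t => \sum_(i <- i :: s) f' i t) =
    fun t => f' i t + \sum_(i <- s) f' i t.
  by apply/funext => t; rewrite big_cons.
exact: derives_toD.
Qed.

Lemma derives_to_exp f f' : derives_to f f' ->
  derives_to (fun t => expR (f t)) (fun t => expR (f t) * f' t).
Proof.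
move=> [cf df]; split=> [t|t t0].
  by apply: continuous_comp; [exact: cf|exact: continuous_expR].
by apply: is_derive1_comp; exact: df.
Qed.

Lemma derives_to_id : derives_to (fun t => t) (fun=> 1).
Proof. by split=> [t|t _]; [exact: cvg_id|exact: is_derive_id]. Qed.

Lemma derives_to_ext f f' g' : derives_to f f' ->
  (forall t, 0 < t -> f' t = g' t) -> derives_to f g'.
Proof. by move=> [cf df] e; split=> // t t0; rewrite -e//; exact: df. Qed.

Lemma derives_to_mvt f f' (s t : R) : derives_to f f' -> 0 <= s -> s < t ->
  exists2 c, s < c < t & f t - f s = f' c * (t - s).
Proof.
move=> [cf df] s0 st.
have [||c cst e] := @MVT R f f' s t st.
- by move=> x; rewrite in_itv/= => /andP[sx _]; apply: df; exact: le_lt_trans sx.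
- exact: continuous_subspaceT.
- by exists c.
Qed.

Lemma derives_to_ge f f' (s t : R) : derives_to f f' ->
  (forall u, 0 < u -> 0 <= f' u) -> 0 <= s -> s <= t -> f s <= f t.
Proof.
move=> df f0 s0; rewrite le_eqVlt => /predU1P[->//|st].
have [c /andP[sc ct] e] := derives_to_mvt df s0 st.
rewrite -subr_ge0 e mulr_ge0 ?subr_ge0 ?(ltW st)//.
by apply: f0; exact: le_lt_trans sc.
Qed.

(** Both g - f and g + f are nondecreasing. This replaces bounding the integral of f' by that of
    g'. *)
Lemma derives_to_dist f f' g g' (s t : R) : derives_to f f' -> derives_to g g' ->
  (forall u, 0 < u -> `|f' u| <= g' u) -> 0 <= s -> s <= t ->
  `|f t - f s| <= g t - g s.
Proof.
move=> df dg fg s0 st.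
have h1 := derives_to_ge (derives_toD dg (derives_toN df)) _ s0 st.
have h2 := derives_to_ge (derives_toD dg df) _ s0 st.
have {}h1 : g s - f s <= g t - f t.
  by apply: h1 => u u0; have := fg u u0; rewrite ler_norml => /andP[]; lra.
have {}h2 : g s + f s <= g t + f t.
  by apply: h2 => u u0; have := fg u u0; rewrite ler_norml => /andP[]; lra.
rewrite ler_norml; apply/andP; split; lra.
Qed.

Lemma derives_to_le f f' g g' (t : R) : derives_to f f' -> derives_to g g' ->
  (forall u, 0 < u -> `|f' u| <= g' u) -> `|f 0| <= g 0 -> 0 <= t ->
  `|f t| <= g t.
Proof.
move=> df dg fg fg0 t0.
have h := derives_to_dist df dg fg (lexx 0) t0.
rewrite -[f t](subrK (f 0)); apply: le_trans (ler_normD _ _) _; lra.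
Qed.

(* Before a hypothetical t with f t > 0, look at the last time s with f s <= 0
   and apply the mean value theorem between s and t. *)
Lemma barrier f f' : derives_to f f' -> f 0 <= 0 ->
  (forall t, 0 < t -> 0 < f t -> f' t <= 0) -> forall t, 0 <= t -> f t <= 0.
Proof.
move=> df f0 f'0 t t0; rewrite leNgt; apply/negP => ft.
pose A := [set s | 0 <= s <= t /\ f s <= 0].
have A0 : A 0 by rewrite /A/= lexx t0.
have hA : has_sup A by split; [exists 0|exists t => s [/andP[]]].
have s0 : 0 <= sup A by apply: ub_le_sup => //; case: hA.
have st : sup A <= t by apply: ge_sup; [exists 0|move=> s [/andP[]]].
have fs : f (sup A) <= 0.
  rewrite leNgt; apply/negP => fs.
  have := df.1 (sup A); move/cvgrPdist_lt => /(_ _ fs)[d/= d0 hd].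
  have [s As ds] := sup_adherent d0 hA.
  have sA : s <= sup A by apply: ub_le_sup => //; case: hA.
  have := hd s; rewrite /ball_/= ger0_norm ?subr_ge0//.
  have -> : sup A - s < d by lra.
  move=> /(_ isT) h; case: As => _ fs0.
  have := ler_norm (f (sup A) - f s); lra.
have {}st : sup A < t.
  by rewrite lt_neqAle st andbT; apply/eqP => e; move: fs; rewrite e leNgt ft.
have [c /andP[sc ct] e] := derives_to_mvt df s0 st.
have c0 : 0 < c by exact: le_lt_trans sc.
have fc : 0 < f c.
  rewrite ltNge; apply/negP => fc.
  have : c <= sup A.
    by apply: ub_le_sup; [case: hA|split=> //; rewrite (ltW c0) (ltW ct)].
  by rewrite leNgt sc.
have : f' c * (t - sup A) <= 0.
  by rewrite mulr_le0_ge0 ?f'0// subr_ge0 ltW.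
rewrite -e; lra.
Qed.

Lemma primitive g : continuous g ->
  exists P : R -> R, [/\ continuous P, P 0 = 0 &
    forall t : R, 0 <= t -> is_derive t 1 P (g t)].
Proof.
(* Integrating from -1 makes 0 an interior point, so that the derivative there is two-sided. *)
move=> cg; pose F (x : R) := (\int[@lebesgue_measure R]_(t in `[(-1)%R, x]) g t).
have dF (x : R) : -1 < x -> is_derive x 1 F (g x).
  move=> x1.
  have [|||d e] := @continuous_FTC1_closed R g (-1) x (x + 1) _ _ _ (cg x).
  - by rewrite ltrDl.
  - apply: continuous_compact_integrable; first exact: segment_compact.
    exact: continuous_subspaceT.
  - by [].
  - by apply: DeriveDef => //; rewrite -derive1E.
(* The cut at -1/2 keeps the argument where F is differentiable, hence P is continuous on the whole
   line, and it changes nothing near t >= 0. *)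
pose P (t : R) := F (Num.max t (- 2^-1)) - F 0.
exists P; split.
- move=> t; apply: cvgB; last exact: cvg_cst.
  apply: (@continuous_comp _ _ _ (fun t : R => Num.max t (- 2^-1)) F).
    by apply: (@continuous_max _ _ idfun (cst (- 2^-1))); [exact: cvg_id|exact: cvg_cst].
  apply: differentiable_continuous; apply/derivable1_diffP.
  have [] // := dF (Num.max t (- 2^-1)).
  by rewrite lt_max orbC; apply/orP; left; lra.
- by rewrite /P max_l ?subrr//; lra.
- move=> t t0; apply: (@near_eq_is_derive _ _ _ (fun t => F t - F 0)).
    near=> s; rewrite /P max_l//.
    apply: ltW; near: s; apply: cvgr_gt; [exact: cvg_id|lra].
  rewrite -[g t]subr0; apply: is_deriveB; apply: dF; lra.
Unshelve. all: by end_near. Qed.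

Lemma dyadic_le (a b C : R) : (forall n, a <= b + C / 2 ^+ n) -> a <= b.
Proof.
move=> h; rewrite leNgt; apply/negP => ba; have e0 : 0 < a - b by rewrite subr_gt0.
have [n hn] : exists n : nat, C / (a - b) < 2 ^+ n.
  exists (Num.bound (`|C| / (a - b))).
  apply: (@le_lt_trans _ _ (`|C| / (a - b))).
    by rewrite ler_pM2r ?invr_gt0// ler_norm.
  apply: lt_le_trans (archi_boundP _) _; first by rewrite divr_ge0// ltW.
  by rewrite -natrX ler_nat ltnW// ltn_expl.
have := h n; rewrite -lerBlDl ler_pdivlMr ?exprn_gt0// leNgt mulrC.
by rewrite -ltr_pdivrMr// hn.
Qed.

(** The intervals with centre u n and radius 2 C / 2^n, the tail of the geometric series, are
    nested; the limit is the supremum of their left endpoints. *)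
Lemma dyadic_limit (u : nat -> R) (C : R) :
  (forall n, `|u n.+1 - u n| <= C / 2 ^+ n) ->
  exists l, forall n, `|u n - l| <= 2 * (C / 2 ^+ n).
Proof.
move=> hu; pose e n := C / 2 ^+ n.
have eS n : e n = 2 * e n.+1.
  rewrite /e exprS invfM; field; exact: lt0r_neq0 (exprn_gt0 _ _).
have e0 n : 0 <= e n by exact: le_trans (normr_ge0 _) (hu n).
have hS n : u n - 2 * e n <= u n.+1 - 2 * e n.+1 /\ u n.+1 + 2 * e n.+1 <= u n + 2 * e n.
  have := hu n; rewrite -/(e n) ler_norml => /andP[h1 h2].
  have := eS n; split; lra.
have mono (n k : nat) : u n - 2 * e n <= u (n + k)%N - 2 * e (n + k)%N /\
                u (n + k)%N + 2 * e (n + k)%N <= u n + 2 * e n.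
  elim: k => [|k [IH1 IH2]]; first by rewrite addn0.
  by rewrite addnS; have [h1 h2] := hS (n + k)%N; split; lra.
have ab (n k : nat) : u n - 2 * e n <= u k + 2 * e k.
  have [/subnKC kE|/ltnW/subnKC kE] := leqP n k.
    by have := mono n (k - n)%N; rewrite kE; have := e0 k; lra.
  by have := mono k (n - k)%N; rewrite kE; have := e0 n; lra.
pose A := range (fun n => u n - 2 * e n).
have hA : has_sup A.
  by split; [exists (u 0%N - 2 * e 0%N); exists 0%N|exists (u 0%N + 2 * e 0%N) => _ [n _ <-]].
exists (sup A) => n; rewrite -/(e n) distrC.
have h1 : u n - 2 * e n <= sup A by apply: ub_le_sup; [case: hA|exists n].
have h2 : sup A <= u n + 2 * e n by apply: ge_sup; [case: hA|move=> _ [k _ <-]].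
rewrite ler_norml; apply/andP; split; lra.
Qed.

End Curves.

(** * Picard iteration with a time-dependent bound and Lipschitz constant *)

Section Picard.
Variables (R : realType) (m : nat) (G : R -> 'rV[R]_m -> 'I_m -> R) (L : R -> R).
Hypothesis L_continuous : continuous L.
Hypothesis L_ge0 : forall t : R, 0 <= t -> 0 <= L t.
Hypothesis G_bounded : forall (t : R) (x : 'rV[R]_m) i, 0 <= t -> `|G t x i| <= L t.
Hypothesis G_lipschitz : forall (t : R) (x y : 'rV[R]_m) (d : R), 0 <= t -> 0 < d ->
  (forall i, `|x 0 i - y 0 i| <= d) -> forall i, `|G t x i - G t y i| <= L t * d.

(* The Bielecki weight: since F' = 2 L F, one Picard step halves any bound of
   the form C F on the distance of two curves. *)
Lemma bielecki_weight : exists F : R -> R,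
  [/\ derives_to F (fun t => 2 * L t * F t), forall t : R, 0 <= t -> 1 <= F t & F 0 = 1].
Proof.
have [P [cP P0 dP]] := primitive L_continuous.
have dP' : derives_to P L by split=> // t /ltW; exact: dP.
have dP2 : derives_to (fun t => expR (2 * P t)) (fun t => 2 * L t * expR (2 * P t)).
  apply: derives_to_ext (derives_to_exp (derives_toM (derives_to_cst 2) dP')) _.
  by move=> t t0; ring.
exists (fun t => expR (2 * P t)); split => //; last by rewrite P0 mulr0 expR0.
move=> t t0; rewrite -expR0 ler_expR mulr_ge0// -P0.
by apply: (derives_to_ge dP') => // u /ltW; exact: L_ge0.
Qed.

(** The distance of two solutions is at most F / 2^n for every n: boundedness of the field gives the
    case n = 0, since 2 L <= 2 L F = F', and each use of the Lipschitz bound halves the estimate. *)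
Lemma picard_unique (x y : R -> 'rV[R]_m) :
  (forall i, derives_to (fun t => x t 0 i) (fun t => G t (x t) i)) ->
  (forall i, derives_to (fun t => y t 0 i) (fun t => G t (y t) i)) ->
  x 0 = y 0 -> forall t : R, 0 <= t -> x t = y t.
Proof.
move=> dx dy xy0 t t0; have [F [dF F1 F0]] := bielecki_weight.
have dxy i := derives_toD (dx i) (derives_toN (dy i)).
have bound n : forall i (s : R), 0 <= s -> `|x s 0 i - y s 0 i| <= F s / 2 ^+ n.
  elim: n => [|n IH] i s s0.
    rewrite expr0 divr1; apply: derives_to_le (dxy i) dF _ _ s0.
      move=> u u0; have u0' := ltW u0; apply: le_trans (ler_normB _ _) _.
      have := G_bounded (x u) i u0'; have := G_bounded (y u) i u0'.
      have := L_ge0 u0'; have := F1 _ u0'; nra.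
    by rewrite xy0 subrr normr0 F0.
  apply: derives_to_le (dxy i) (derives_toM dF (derives_to_cst (2 ^+ n.+1)^-1)) _ _ s0.
    move=> u u0; have u0' := ltW u0.
    have h := G_lipschitz u0' _ (fun j => IH j u u0') i.
    apply: le_trans (h _) _; first by rewrite divr_gt0 ?exprn_gt0// (lt_le_trans _ (F1 _ _)).
    rewrite mulr0 add0r exprS invfM le_eqVlt; apply/orP; left; apply/eqP.
    by field; rewrite lt0r_neq0 ?exprn_gt0.
  by rewrite xy0 subrr normr0 F0 mul1r invr_ge0 exprn_ge0.
apply/rowP => i; apply/eqP; rewrite -subr_eq0 -normr_le0.
by apply: (@dyadic_le _ _ _ (F t)) => n; rewrite add0r; exact: bound.
Qed.

Hypothesis G_continuous : forall x : R -> 'rV[R]_m,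
  (forall i, continuous (fun t => x t 0 i)) -> forall i, continuous (fun t => G t (x t) i).

Lemma picard_step (x0 : 'rV[R]_m) (x : R -> 'rV[R]_m) :
  (forall i, continuous (fun t => x t 0 i)) ->
  exists y : R -> 'rV[R]_m, [/\ forall i, continuous (fun t => y t 0 i), y 0 = x0 &
    forall i (t : R), 0 <= t -> is_derive t 1 (fun t => y t 0 i) (G t (x t) i)].
Proof.
move=> cx; have [P hP] := choice (fun i => primitive (@G_continuous x cx i)).
exists (fun t => \row_i (x0 0 i + P i t)).
have E i : (fun t => (\row_i (x0 0 i + P i t)) 0 i) = fun t => x0 0 i + P i t.
  by apply/funext => t; rewrite mxE.
split=> [i|| i t t0].
- rewrite E => t; apply: cvgD; first exact: cvg_cst.
  by have [+ _ _] := hP i; exact.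
- by apply/rowP => i; rewrite mxE; have [_ -> _] := hP i; rewrite addr0.
- rewrite E -[G _ _ _]add0r; apply: is_deriveD.
  by have [_ _ dP] := hP i; exact: dP.
Qed.

Lemma picard_exists (x0 : 'rV[R]_m) : exists z : R -> 'rV[R]_m,
  [/\ forall i, continuous (fun t => z t 0 i), z 0 = x0 &
    forall i (t : R), 0 <= t -> is_derive t 1 (fun t => z t 0 i) (G t (z t) i)].
Proof.
have [F [dF F1 F0]] := bielecki_weight.
(* Continuity of [x] is assumed only after [y] is produced, so that choice yields a Picard operator
   [S] defined on all curves. *)
have /choice[S hS] : forall x : R -> 'rV[R]_m, exists y : R -> 'rV[R]_m,
    (forall i, continuous (fun t => x t 0 i)) ->
    [/\ forall i, continuous (fun t => y t 0 i), y 0 = x0 &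
    forall i (t : R), 0 <= t -> is_derive t 1 (fun t => y t 0 i) (G t (x t) i)].
  move=> x; have [cx|ncx] := pselect (forall i, continuous (fun t => x t 0 i)).
    by have [y hy] := picard_step x0 cx; exists y.
  by exists x.
pose X n := iter n S (fun=> x0).
have cX n : forall i, continuous (fun t => X n t 0 i).
  elim: n => [|n IH]; first by move=> i t; exact: cvg_cst.
  by have [] := hS _ IH.
have X0 n : X n 0 = x0 by case: n => [//|n]; have [] := hS _ (cX n).
have dX n i : derives_to (fun t => X n.+1 t 0 i) (fun t => G t (X n t) i).
  split=> [|t t0]; first exact: cX.
  by have [_ _ h] := hS _ (cX n); apply: h; exact: ltW.
have LF t : 0 <= t -> L t <= 2 * L t * F t.
  by move=> t0; have := L_ge0 t0; have := F1 _ t0; nra.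
have halve n (x y : 'rV[R]_m) t i : 0 <= t ->
    (forall j, `|x 0 j - y 0 j| <= 2 * (F t / 2 ^+ n)) ->
    `|G t x i - G t y i| <= 2 * L t * F t / 2 ^+ n.
  move=> t0 h; apply: le_trans (G_lipschitz t0 _ h i) _.
    by rewrite mulr_gt0// divr_gt0 ?exprn_gt0// (lt_le_trans _ (F1 _ _)).
  by rewrite le_eqVlt; apply/orP; left; apply/eqP; ring.
have dFn n : derives_to (fun t => F t / 2 ^+ n) (fun t => 2 * L t * F t / 2 ^+ n).
  apply: derives_to_ext (derives_toM dF (derives_to_cst (2 ^+ n)^-1)) _.
  by move=> t t0; ring.
have twice n t : 2 * (F t / 2 ^+ n.+1) = F t / 2 ^+ n.
  by rewrite exprS invfM; field; rewrite lt0r_neq0 ?exprn_gt0.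
have F0n n : 0 <= F 0 / 2 ^+ n by rewrite F0 mul1r invr_ge0 exprn_ge0.
have Xstep n : forall i t, 0 <= t -> `|X n.+1 t 0 i - X n t 0 i| <= F t / 2 ^+ n.
  elim: n => [|n IH] i t t0.
    have dx := derives_toD (dX 0 i) (derives_to_cst (- x0 0 i)).
    apply: derives_to_le dx (dFn 0%N) _ _ t0.
      move=> u u0; rewrite addr0 expr0 divr1; apply: le_trans (LF _ (ltW u0)).
      exact: G_bounded (ltW u0).
    by rewrite X0 subrr normr0.
  have dx := derives_toD (dX n.+1 i) (derives_toN (dX n i)).
  apply: derives_to_le dx (dFn n.+1) _ _ t0; last by rewrite !X0 subrr normr0.
  move=> u u0; apply: halve (ltW u0) _ => j; rewrite twice; exact: IH (ltW u0).
have /choice[l hl] : forall t : R, exists l : 'rV[R]_m, 0 <= t ->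
    forall n i, `|X n t 0 i - l 0 i| <= 2 * (F t / 2 ^+ n).
  move=> t; have [t0|_] := leP 0 t; last by exists 0.
  have /choice[l hl] : forall i, exists l, forall n,
      `|X n t 0 i - l| <= 2 * (F t / 2 ^+ n).
    by move=> i; apply: dyadic_limit => n; exact: Xstep.
  by exists (\row_i l i) => _ n i; rewrite mxE.
(* The iterates have speed at most L <= 2 L F = F'. This modulus survives the pointwise limit and
   makes it continuous. *)
have ldist i s t : 0 <= s -> s <= t -> `|l t 0 i - l s 0 i| <= F t - F s.
  move=> s0 st; have t0 := le_trans s0 st.
  apply: (@dyadic_le _ _ _ (F t + F s)) => n.
  have h1 := hl t t0 n.+1 i; have h2 := hl s s0 n.+1 i; rewrite !twice in h1 h2.
  have := derives_to_dist (dX n i) dF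
    (fun u u0 => le_trans (G_bounded _ _ (ltW u0)) (LF _ (ltW u0))) s0 st.
  rewrite mulrDl; move: h1 h2; rewrite !ler_norml.
  move=> /andP[? ?] /andP[? ?] /andP[? ?]; apply/andP; split; lra.
pose x t := l (Num.max t 0).
have cmax : continuous (fun t : R => Num.max t 0).
  move=> t; apply: (@continuous_max _ _ idfun (cst 0)); first exact: cvg_id.
  exact: cvg_cst.
have cx i : continuous (fun t => x t 0 i).
  move=> t; apply/cvgrPdist_le => e e0.
  have /cvgrPdist_le/(_ e e0) : F (Num.max s 0) @[s --> t] --> F (Num.max t 0).
    by apply: (@continuous_comp _ _ _ (fun t : R => Num.max t 0) F);
      [exact: cmax|exact: dF.1].
  apply: filterS => s; apply: le_trans; rewrite /x.
  have a0 : 0 <= Num.max t 0 by rewrite le_max lexx orbT.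
  have b0 : 0 <= Num.max s 0 by rewrite le_max lexx orbT.
  have [ab|/ltW ab] := leP (Num.max t 0) (Num.max s 0).
    rewrite distrC [leRHS]distrC; exact: le_trans (ldist _ _ _ a0 ab) (ler_norm _).
  exact: le_trans (ldist _ _ _ b0 ab) (ler_norm _).
(* The witness is [S x] and not [x], because its derivative at 0 is two-sided while [x] is frozen at
   negative times. At t >= 0 both lie within F / 2^n of the iterate n + 1, hence they agree. *)
have [cz z0 dz] := hS x cx; exists (S x).
have xz t : 0 <= t -> x t = S x t.
  move=> t0; apply/rowP => i; apply/eqP; rewrite -subr_eq0 -normr_le0.
  apply: (@dyadic_le _ _ _ (2 * F t)) => n; rewrite add0r.
  have dxz := derives_toD (dX n i) (derives_toN
    (conj (cz i) (fun t t0 => dz i t (ltW t0)) : derives_to _ (fun t => G t (x t) i))).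
  have : `|X n.+1 t 0 i - S x t 0 i| <= F t / 2 ^+ n.
    apply: derives_to_le dxz (dFn n) _ _ t0; last by rewrite X0 z0 subrr normr0.
    move=> u u0; apply: halve (ltW u0) _ => j.
    rewrite /x max_l ?(ltW u0)//; exact: hl (ltW u0) _ _.
  have := hl t t0 n.+1 i; rewrite twice /x max_l// -mulrA !ler_norml.
  move=> /andP[? ?] /andP[? ?]; apply/andP; split; lra.
by split=> // i t t0; rewrite -xz//; exact: dz.
Qed.

End Picard.

(** * Distance, transport and the lazy random walk *)

Section Distance.
Variables (R : realType) (V : finType) (m : nat) (G : graph V m).
Implicit Types (w : 'rV[R]_m) (u v x y z : V) (p : seq V).

Lemma adj_sym x y : adj G x y = adj G y x.
Proof. by rewrite /adj; under eq_existsb => i do rewrite finset.setUC. Qed.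

Lemma adj_irr x : adj G x x = false.
Proof.
apply/negbTE/existsPn => i; apply/eqP => /setP e.
have := e (ends G i).1; have := e (ends G i).2.
rewrite /edge !inE !eqxx /= orbT !orbb => /esym/eqP a /esym/eqP b.
by have := ends_neq G i; rewrite a b eqxx.
Qed.

Lemma adj_ends i : adj G (ends G i).1 (ends G i).2.
Proof. by apply/existsP; exists i. Qed.

Lemma weight_ends w i : weight G w (ends G i).1 (ends G i).2 = w 0 i.
Proof.
rewrite /weight (big_pred1 i)// => j; apply/eqP/eqP => [e|->//].
exact: (@ends_inj _ _ G).
Qed.

Lemma weight_ge0 w x y : (forall i, 0 <= w 0 i) -> 0 <= weight G w x y.
Proof. by move=> w0; apply: sumr_ge0. Qed.

Lemma weight_scale w w' c x y : (forall i, w 0 i <= c * w' 0 i) ->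
  weight G w x y <= c * weight G w' x y.
Proof. by move=> ww'; rewrite /weight mulr_sumr; apply: ler_sum. Qed.

Lemma weight_le_sum w x y : (forall i, 0 <= w 0 i) -> weight G w x y <= \sum_i w 0 i.
Proof.
by move=> w0; rewrite /weight [leRHS](bigID (fun i => edge G i == [set x; y]%SET))/= lerDl sumr_ge0.
Qed.

Lemma weight_ge w c x y : 0 <= c -> (forall i, c <= w 0 i) -> adj G x y ->
  c <= weight G w x y.
Proof.
move=> c0 wc /existsP[i ixy]; rewrite /weight (bigD1 i)//=.
by rewrite (le_trans (wc i))// lerDl sumr_ge0// => j _; exact: le_trans (wc j).
Qed.

Lemma path_length_cons w u x p :
  path_length G w u (x :: p) = weight G w u x + path_length G w x p.
Proof. by rewrite /path_length /= big_cons. Qed.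

Lemma path_length_ge0 w u p : (forall i, 0 <= w 0 i) -> 0 <= path_length G w u p.
Proof.
move=> w0; elim: p u => [|x p IH] u; first by rewrite /path_length big_nil.
by rewrite path_length_cons addr_ge0// weight_ge0.
Qed.

Lemma path_length_scale w w' c u p : (forall i, w 0 i <= c * w' 0 i) ->
  path_length G w u p <= c * path_length G w' u p.
Proof.
move=> ww'; elim: p u => [|x p IH] u; first by rewrite /path_length !big_nil mulr0.
by rewrite !path_length_cons mulrDr lerD// weight_scale.
Qed.

Lemma path_length_le w u p : (forall i, 0 <= w 0 i) ->
  path_length G w u p <= (size p)%:R * \sum_i w 0 i.
Proof.
move=> w0; elim: p u => [|x p IH] u; first by rewrite /path_length big_nil mul0r.
by rewrite path_length_cons /= -natr1 mulrDl mul1r addrC lerD// weight_le_sum.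
Qed.

Lemma dist_le_path w u p : (forall i, 0 <= w 0 i) -> path (adj G) u p ->
  dist G w u (last u p) <= path_length G w u p.
Proof.
move=> w0 up; apply: ge_inf; last by exists p.
by exists 0 => _ [q _ <-]; exact: path_length_ge0.
Qed.

Lemma dist_le_weight w i : (forall i, 0 <= w 0 i) -> rho G w i <= w 0 i.
Proof.
move=> w0; rewrite -weight_ends.
have := @dist_le_path w (ends G i).1 [:: (ends G i).2] w0.
by rewrite /= adj_ends path_length_cons [path_length _ _ _ [::]]big_nil addr0; exact.
Qed.

Hypothesis Gconn : connected_graph G.

(** Connectedness makes the set of path lengths nonempty, without which [inf] would be a mere
    default value. *)
Lemma dist_ge w u v c :
  (forall p, path (adj G) u p -> last u p = v -> c <= path_length G w u p) ->
  c <= dist G w u v.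
Proof.
move=> h; apply: lb_le_inf; last by move=> _ [p [up pv] <-]; exact: h.
have /connectP[p up pv] := Gconn u v.
by exists (path_length G w u p), p.
Qed.

Lemma dist_ge0 w u v : (forall i, 0 <= w 0 i) -> 0 <= dist G w u v.
Proof. by move=> w0; apply: dist_ge => p _ _; exact: path_length_ge0. Qed.

(** A multiplicative comparison of weights passes to path lengths with the same factor, whatever the
    number of edges of the path. *)
Lemma dist_scale w w' c u v : 0 < c -> (forall i, 0 <= w 0 i) ->
  (forall i, w 0 i <= c * w' 0 i) -> dist G w u v <= c * dist G w' u v.
Proof.
move=> c0 w0 ww'; rewrite mulrC -ler_pdivrMr//; apply: dist_ge => p up <-.
rewrite ler_pdivrMr// mulrC; apply: le_trans (dist_le_path w0 up) _.
exact: path_length_scale.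
Qed.

Lemma dist_le w u v : (forall i, 0 <= w 0 i) ->
  dist G w u v <= #|V|%:R * \sum_i w 0 i.
Proof.
move=> w0; have /connectP[p up ->] := Gconn u v.
(* A path without repeated vertices has fewer than |V| edges. *)
case/shortenP: up => q uq /card_uniqP qV _.
apply: le_trans (dist_le_path w0 uq) _; apply: le_trans (path_length_le _ _ w0) _.
rewrite ler_wpM2r ?sumr_ge0// ler_nat.
by apply: ltnW; move: (max_card (mem (u :: q))); rewrite qV.
Qed.

Lemma dist_ge_min w c u v : u != v -> 0 <= c -> (forall i, c <= w 0 i) ->
  c <= dist G w u v.
Proof.
move=> uv c0 wc; apply: dist_ge => -[|x p] /=; first by move=> _ e; rewrite e eqxx in uv.
move=> /andP[ux _] _; rewrite path_length_cons (le_trans (weight_ge c0 wc ux))//.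
by rewrite lerDl path_length_ge0// => i; exact: le_trans (wc i).
Qed.

End Distance.

(** * Couplings and transportation distance *)

Section Transport.
Variables (R : realType) (V : finType).
Implicit Types (f g : V -> R) (A : V -> V -> R).

Definition is_prob f := (forall u, 0 <= f u) /\ \sum_u f u = 1.

(** An entry is at most its row sum, hence at most the total mass 1. *)
Lemma is_couplingP f g A : is_prob f -> (forall u v, 0 <= A u v) ->
  (forall u, \sum_v A u v = f u) -> (forall v, \sum_u A u v = g v) ->
  coupling f g A.
Proof.
move=> [f0 f1] A0 Af Ag; split=> // u v; rewrite A0 /= -f1.
rewrite (bigD1 u)//= -Af (bigD1 v)//= -addrA lerDl addr_ge0 ?sumr_ge0//.
Qed.

Lemma prod_coupling f g : is_prob f -> is_prob g ->
  coupling f g (fun u v => f u * g v).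
Proof.
move=> pf pg; apply: is_couplingP => //.
- by move=> u v; rewrite mulr_ge0 ?pf.1 ?pg.1.
- by move=> u; rewrite -mulr_sumr pg.2 mulr1.
- by move=> v; rewrite -mulr_suml pf.2 mul1r.
Qed.

Lemma coupling_sum f g A : is_prob f -> coupling f g A -> \sum_u \sum_v A u v = 1.
Proof. by move=> [_ f1] [_ Af _]; rewrite -f1; apply: eq_bigr. Qed.

Variables (m : nat) (G : graph V m).
Hypothesis Gconn : connected_graph G.
Implicit Types w : 'rV[R]_m.

Definition cost w A := \sum_u \sum_v A u v * dist G w u v.

Lemma cost_ge0 w f g A : (forall i, 0 <= w 0 i) -> coupling f g A -> 0 <= cost w A.
Proof.
move=> w0 [A0 _ _]; apply: sumr_ge0 => u _; apply: sumr_ge0 => v _.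
by rewrite mulr_ge0 ?dist_ge0//; have /andP[] := A0 u v.
Qed.

Lemma cost_le w f g A D : is_prob f -> coupling f g A ->
  (forall u v, dist G w u v <= D) -> cost w A <= D.
Proof.
move=> pf cA dD; rewrite -[leRHS]mul1r -(coupling_sum pf cA) mulr_suml.
apply: ler_sum => u _; rewrite mulr_suml; apply: ler_sum => v _.
by rewrite ler_wpM2l//; case: cA => /(_ u v)/andP[].
Qed.

Lemma transport_le_cost w f g A : (forall i, 0 <= w 0 i) -> coupling f g A ->
  transport G w f g <= cost w A.
Proof.
move=> w0 cA; apply: ge_inf; last by exists A.
by exists 0 => _ [B cB <-]; exact: cost_ge0 cB.
Qed.

Lemma transport_ge w f g c : is_prob f -> is_prob g ->
  (forall A, coupling f g A -> c <= cost w A) -> c <= transport G w f g.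
Proof.
move=> pf pg h; apply: lb_le_inf; last by move=> _ [A cA <-]; exact: h.
by eexists; exists (fun u v => f u * g v); [exact: prod_coupling|reflexivity].
Qed.

Lemma transport_ge0 w f g : (forall i, 0 <= w 0 i) -> is_prob f -> is_prob g ->
  0 <= transport G w f g.
Proof. by move=> w0 pf pg; apply: transport_ge => // A; exact: cost_ge0. Qed.

Lemma transport_le w f g D : (forall i, 0 <= w 0 i) -> is_prob f -> is_prob g ->
  (forall u v, dist G w u v <= D) -> transport G w f g <= D.
Proof.
move=> w0 pf pg dD; have cA := prod_coupling pf pg.
exact: le_trans (transport_le_cost w0 cA) (cost_le pf cA dD).
Qed.

(* If th f <= f' and th g <= g', then a coupling of f and g scaled by th
   leaves total mass 1 - th to be transported arbitrarily. *)
Lemma transport_perturb w w' f g f' g' th c D :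
  (forall i, 0 <= w' 0 i) -> is_prob f -> is_prob g -> is_prob f' -> is_prob g' ->
  0 < th < 1 -> 0 < c -> th * c <= 1 ->
  (forall u, th * f u <= f' u) -> (forall u, th * g u <= g' u) ->
  (forall u v, dist G w' u v <= c * dist G w u v) ->
  (forall i, 0 <= w 0 i) ->
  (forall u v, dist G w' u v <= D) ->
  transport G w' f' g' <= transport G w f g + (1 - th) * D.
Proof.
move=> w'0 pf pg pf' pg' /andP[th0 th1] c0 thc ff gg dd w0 dD.
rewrite -lerBlDr; apply: transport_ge => // A cA.
have th1' : 0 < 1 - th by rewrite subr_gt0.
pose q h h' (u : V) : R := (h' u - th * h u) / (1 - th).
have pq (h h' : V -> R) : is_prob h -> is_prob h' -> (forall u, th * h u <= h' u) ->
    is_prob (q h h').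
  move=> ph ph' hh; split; first by move=> u; rewrite divr_ge0 ?(ltW th1')// subr_ge0.
  by rewrite -mulr_suml sumrB -mulr_sumr ph.2 ph'.2 mulr1 divff// gt_eqF.
have pqf := pq _ _ pf pf' ff; have pqg := pq _ _ pg pg' gg.
pose B u v := th * A u v + (1 - th) * (q f f' u * q g g' v).
have qE h h' u : (1 - th) * q h h' u = h' u - th * h u.
  by rewrite /q mulrC divfK// gt_eqF.
have [A0 Af Ag] := cA; have [B0 Bf Bg] := prod_coupling pqf pqg.
have cB : coupling f' g' B.
  apply: is_couplingP => // [u v|u|v].
  - have /andP[a0 _] := A0 u v; have /andP[b0 _] := B0 u v.
    by rewrite addr_ge0// mulr_ge0// ltW.
  - by rewrite big_split /= -!mulr_sumr Af pqg.2 mulr1 qE addrC subrK.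
  - rewrite big_split /= -!mulr_sumr Ag -mulr_suml pqf.2 mul1r qE addrC.
    by rewrite subrK.
rewrite lerBlDr; apply: le_trans (transport_le_cost w'0 cB) _.
have -> : cost w' B = th * cost w' A + (1 - th) * cost w' (fun u v => q f f' u * q g g' v).
  rewrite /cost !mulr_sumr -big_split; apply: eq_bigr => u _ /=.
  rewrite !mulr_sumr -big_split; apply: eq_bigr => v _ /=.
  by rewrite /B mulrDl !mulrA.
apply: lerD; last first.
  rewrite ler_wpM2l ?(ltW th1')//; exact: cost_le pqf (prod_coupling pqf pqg) dD.
(* The factor c from the change of metric is absorbed by th c <= 1. *)
apply: (@le_trans _ _ (th * (c * cost w A))).
  rewrite ler_wpM2l ?(ltW th0)// /cost !mulr_sumr; apply: ler_sum => u _.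
  rewrite !mulr_sumr; apply: ler_sum => v _.
  by rewrite mulrCA ler_wpM2l//; have /andP[] := A0 u v.
rewrite mulrA -[leRHS]mul1r ler_wpM2r//; exact: cost_ge0 cA.
Qed.

End Transport.

(** * Dependence of the lazy random walk on weight and idleness *)

Section RandomWalk.
Variables (R : realType) (V : finType) (m : nat) (G : graph V m).
Hypothesis Gconn : connected_graph G.
Implicit Types (w : 'rV[R]_m) (u v x y z : V).

Definition step w u z : R :=
  if adj G z u then weight G w z u / \sum_(y | adj G y u) weight G w y u else 0.

(** No vertex is its own neighbour, so the measure splits into an atom and a multiple of a measure
    that does not involve the idleness. *)
Lemma muE w a u z : mu G w a u z = (if z == u then a else 0) + (1 - a) * step w u z.
Proof.
rewrite /mu /step; case: eqVneq => [->|_]; first by rewrite adj_irr mulr0 addr0.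
by rewrite add0r; case: ifP => // _; rewrite mulr0.
Qed.

Lemma step_ge0 w u z : (forall i, 0 <= w 0 i) -> 0 <= step w u z.
Proof.
move=> w0; rewrite /step; case: ifP => // _.
by rewrite divr_ge0 ?weight_ge0// sumr_ge0// => y _; exact: weight_ge0.
Qed.

Lemma weight_gt0 w x y : positive_weight w -> adj G x y -> 0 < weight G w x y.
Proof.
move=> w0 /existsP[i ixy]; rewrite /weight (bigD1 i)//=.
by rewrite ltr_pwDl// sumr_ge0// => j _; exact: ltW.
Qed.

Lemma degree_gt0 w u z : positive_weight w -> adj G z u ->
  0 < \sum_(y | adj G y u) weight G w y u.
Proof.
move=> w0 zu; rewrite (bigD1 z)//= ltr_pwDl ?weight_gt0// sumr_ge0// => j _.
by apply: weight_ge0 => i; exact: ltW.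
Qed.

(** The neighbour [z] makes the degree of [u] positive; at an isolated vertex the sum would be 0. *)
Lemma step_sum w u z : positive_weight w -> adj G z u -> \sum_y step w u y = 1.
Proof.
move=> w0 zu; rewrite -big_mkcond -mulr_suml divff// gt_eqF//.
exact: degree_gt0 zu.
Qed.

Lemma mu_prob w a u z : positive_weight w -> adj G z u -> 0 <= a <= 1 ->
  is_prob (mu G w a u).
Proof.
move=> w0 zu /andP[a0 a1]; split=> [y|].
  rewrite muE addr_ge0//; first by case: ifP.
  by rewrite mulr_ge0 ?subr_ge0// step_ge0// => i; exact: ltW.
under eq_bigr do rewrite muE.
by rewrite big_split -big_mkcond /= big_pred1_eq -mulr_sumr (step_sum w0 zu) mulr1; lra.
Qed.

Lemma mu_self w a u : mu G w a u u = a.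
Proof. by rewrite /mu eqxx. Qed.

(** One factor c is lost in the edge weight and one in the degree by which it is divided. *)
Lemma step_scale w w' c u z : positive_weight w -> positive_weight w' -> 0 < c ->
  (forall i, w 0 i <= c * w' 0 i) -> (forall i, w' 0 i <= c * w 0 i) ->
  c ^- 2 * step w u z <= step w' u z.
Proof.
move=> w0 w'0 c0 ww' w'w; rewrite /step; case: ifPn => [zu|_]; last by rewrite mulr0.
have d0 := degree_gt0 w0 zu; have d'0 := degree_gt0 w'0 zu.
have h1 := weight_scale G z u ww'.
have h2 : \sum_(y | adj G y u) weight G w' y u <= c * \sum_(y | adj G y u) weight G w y u.
  by rewrite mulr_sumr; apply: ler_sum => y _; exact: weight_scale.
have a0 : 0 <= weight G w z u by exact/ltW/weight_gt0.
move: h1 h2 a0 d0 d'0; set s := weight G w z u; set s' := weight G w' z u.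
set d := \sum_(y | _) weight G w y u; set d' := \sum_(y | _) weight G w' y u => h1 h2 s0 d0 d'0.
have -> : c ^- 2 * (s / d) = s / (c ^+ 2 * d).
  by field; rewrite !lt0r_neq0.
rewrite ler_pdivlMr// mulrAC ler_pdivrMr ?mulr_gt0 ?exprn_gt0//.
apply: (@le_trans _ _ ((c * s') * (c * d))); first by apply: ler_pM => //; exact: ltW.
by rewrite le_eqVlt; apply/orP; left; apply/eqP; ring.
Qed.

Lemma mu_scale w w' a c u z : positive_weight w -> positive_weight w' -> 1 <= c ->
  0 <= a <= 1 ->
  (forall i, w 0 i <= c * w' 0 i) -> (forall i, w' 0 i <= c * w 0 i) ->
  c ^- 2 * mu G w a u z <= mu G w' a u z.
Proof.
move=> w0 w'0 c1 /andP[a0 a1] ww' w'w; have c0 := lt_le_trans ltr01 c1.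
rewrite !muE mulrDr lerD//.
  case: ifP; rewrite ?mulr0// => _; apply: ler_piMl => //.
  by rewrite invf_le1 ?exprn_gt0// exprn_ege1.
by rewrite mulrCA ler_wpM2l ?subr_ge0// step_scale.
Qed.

(* From a to b, scale a coupling by (1 - b) / (1 - a) and correct the entry at
   (x, y), which is at least 2 a - 1 and hence stays nonnegative. *)
Lemma transport_idle w x y a b : positive_weight w -> adj G x y ->
  2^-1 <= a < 1 -> 2^-1 <= b < 1 ->
  (1 - a)^-1 * (dist G w x y - transport G w (mu G w a x) (mu G w a y)) <=
  (1 - b)^-1 * (dist G w x y - transport G w (mu G w b x) (mu G w b y)).
Proof.
move=> w0 xy /andP[a0 a1] /andP[b0 b1].
have wge0 i : 0 <= w 0 i by exact: ltW.
have yx : adj G y x by rewrite adj_sym.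
have xNy : x != y by apply/eqP => e; move: xy; rewrite e adj_irr.
have a01 : 0 <= a <= 1 by apply/andP; split; lra.
have b01 : 0 <= b <= 1 by apply/andP; split; lra.
have pax := mu_prob w0 yx a01; have pay := mu_prob w0 xy a01.
have pbx := mu_prob w0 yx b01; have pby := mu_prob w0 xy b01.
set d := dist G w x y; set Tb := transport G w (mu G w b x) _.
pose r := (1 - b) / (1 - a).
have r0 : 0 < r by rewrite divr_gt0// subr_gt0.
have rE : r * (1 - a) = 1 - b by rewrite divfK// gt_eqF// subr_gt0.
suff h : d - (d - Tb) / r <= transport G w (mu G w a x) (mu G w a y).
  have -> : (1 - b)^-1 * (d - Tb) = (1 - a)^-1 * ((d - Tb) / r).
    by rewrite /r; field; apply/andP; split; lra.
  rewrite ler_wpM2l ?invr_ge0 ?subr_ge0 ?(ltW a1)//; move: h; lra.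
apply: transport_ge => // A cA.
have [A0 Ax Ay] := cA.
(* Of the mass at least a leaving [x], at most 1 - a can land off [y], since the target measure has
   only that much mass there. *)
have Axy : 2 * a - 1 <= A x y.
  have := Ax x; rewrite mu_self (bigD1 y)//= => e.
  have : \sum_(v | v != y) A x v <= \sum_(v | v != y) mu G w a y v.
    apply: ler_sum => v _; rewrite -Ay (bigD1 x)//= lerDl sumr_ge0// => u _.
    by have /andP[] := A0 u v.
  have := pay.2; rewrite (bigD1 y)//= mu_self; lra.
pose B u v := r * A u v + (if (u == x) && (v == y) then 1 - r else 0).
have cB : coupling (mu G w b x) (mu G w b y) B.
  apply: is_couplingP => // [u v|u|v].
  - rewrite /B; case: andP => [[/eqP -> /eqP ->]|_]; last first.
      by rewrite addr0 mulr_ge0 ?(ltW r0)//; have /andP[] := A0 u v.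
    (* As r (1 - a) = 1 - b, the corrected entry is at least r (2 a - 1) + 1 - r = 2 b - 1 >= 0. *)
    have : r * (2 * a - 1) <= r * A x y by rewrite ler_wpM2l// ltW.
    lra.
  - rewrite big_split /= -mulr_sumr Ax !muE mulrDr mulrA rE addrAC; congr (_ + _).
    case: eqP => [_|_] /=; last by rewrite big1// mulr0 addr0.
    by rewrite -big_mkcond big_pred1_eq; lra.
  - rewrite big_split /= -mulr_sumr Ay !muE mulrDr mulrA rE addrAC; congr (_ + _).
    case: eqP => [_|_] /=; last by rewrite big1 ?mulr0 ?addr0// => u _; rewrite andbF.
    under eq_bigr do rewrite andbT.
    by rewrite -big_mkcond big_pred1_eq; lra.
have := transport_le_cost Gconn wge0 cB.
have -> : cost G w B = r * cost G w A + (1 - r) * d.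
  rewrite /cost mulr_sumr [X in _ = _ + X](_ : _ =
    \sum_u \sum_v (if (u == x) && (v == y) then 1 - r else 0) * dist G w u v).
    rewrite -big_split; apply: eq_bigr => u _ /=.
    rewrite mulr_sumr -big_split; apply: eq_bigr => v _ /=.
    by rewrite /B mulrDl mulrA.
  rewrite (bigD1 x)//= (bigD1 y)//= !eqxx /= !big1 ?addr0//.
    by move=> u /negbTE ux; rewrite big1// => v _; rewrite ux mul0r.
  by move=> v /negbTE vy; rewrite vy mul0r.
rewrite -/Tb => h; rewrite lerBlDl -lerBlDr ler_pdivlMr//; lra.
Qed.

End RandomWalk.

(** * Regularity and bounds of the vector field *)

Section Tame.
Variables (R : realType) (m : nat).
Implicit Types (w : 'rV[R]_m) (f g : 'rV[R]_m -> R).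

Definition box (E : R) w := forall i, E^-1 <= w 0 i <= E.

(* The constants are polynomial in E so that on the box of size E(t) they depend
   continuously on t. *)
Definition tame f := exists C k, 0 <= C /\ forall E : R, 1 <= E -> forall w, box E w ->
  `|f w| <= C * E ^+ k /\ forall w' d, box E w' -> 0 < d ->
  (forall i, `|w 0 i - w' 0 i| <= d) -> `|f w - f w'| <= C * E ^+ k * d.

Lemma box_pos E w : 1 <= E -> box E w -> positive_weight w.
Proof.
move=> E1 wE i; have /andP[+ _] := wE i; apply: lt_le_trans.
by rewrite invr_gt0 (lt_le_trans ltr01).
Qed.

Lemma positive_box w : positive_weight w ->
  exists E, [/\ 1 <= E, box E w & \sum_i w 0 i <= E].
Proof.
(* This number dominates 1, every weight, every inverse weight and the total weight. *)
move=> w0; exists (1 + \sum_i (w 0 i + (w 0 i)^-1)).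
have a0 i : 0 <= w 0 i + (w 0 i)^-1 by rewrite addr_ge0 ?invr_ge0//; exact: ltW.
have ai i : w 0 i + (w 0 i)^-1 <= \sum_i (w 0 i + (w 0 i)^-1).
  by rewrite (bigD1 i)//= lerDl sumr_ge0.
split; first by rewrite lerDl sumr_ge0.
- move=> i; have := ai i; have := w0 i; have : 0 < (w 0 i)^-1 by rewrite invr_gt0.
  move=> wV wi h; apply/andP; split; last lra.
  by rewrite -[leRHS]invrK lef_pV2 ?posrE//; lra.
- rewrite big_split /=; have : 0 <= \sum_i (w 0 i)^-1.
    by apply: sumr_ge0 => i _; rewrite invr_ge0 ltW.
  lra.
Qed.

(** Boxes of size E >= 1 consist of positive weights, so identities that hold only there, such as
    [kappa_rho], may be used. *)
Lemma tame_ext f g : (forall w, positive_weight w -> f w = g w) -> tame f -> tame g.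
Proof.
move=> fg [C [k [C0 h]]]; exists C, k; split=> // E E1 w wE.
have [h1 h2] := h E E1 w wE; rewrite -fg; last exact: box_pos wE.
split=> // w' d w'E d0 ww'; rewrite -fg; last exact: box_pos w'E.
exact: h2.
Qed.

Lemma tame_cst (a : R) : tame (fun=> a).
Proof.
exists `|a|, 0%N; split=> // E E1 w _; rewrite expr0 mulr1; split=> // w' d _ d0 _.
by rewrite subrr normr0 mulr_ge0// ltW.
Qed.

Lemma tameD f g : tame f -> tame g -> tame (fun w => f w + g w).
Proof.
move=> [C [k [C0 h]]] [C' [k' [C'0 h']]]; exists (C + C'), (k + k')%N.
split=> [|E E1 w wE]; first exact: addr_ge0.
have E0 := lt_le_trans ltr01 E1.
have [h1 h2] := h E E1 w wE; have [h'1 h'2] := h' E E1 w wE.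
have le1 : C * E ^+ k <= C * E ^+ (k + k') by rewrite ler_wpM2l// ler_weXn2l// leq_addr.
have le2 : C' * E ^+ k' <= C' * E ^+ (k + k') by rewrite ler_wpM2l// ler_weXn2l// leq_addl.
split=> [|w' d w'E d0 ww']; first by apply: le_trans (ler_normD _ _) _; lra.
have := h2 w' d w'E d0 ww'; have := h'2 w' d w'E d0 ww' => a b.
have -> : f w + g w - (f w' + g w') = (f w - f w') + (g w - g w') by ring.
apply: le_trans (ler_normD _ _) _; rewrite mulrDl mulrDl; apply: lerD.
  by apply: le_trans b _; rewrite ler_wpM2r// ltW.
by apply: le_trans a _; rewrite ler_wpM2r// ltW.
Qed.

Lemma tameM f g : tame f -> tame g -> tame (fun w => f w * g w).
Proof.
move=> [C [k [C0 h]]] [C' [k' [C'0 h']]]; exists (2 * (C * C')), (k + k')%N.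
split=> [|E E1 w wE]; first by rewrite !mulr_ge0.
have E0 := lt_le_trans ltr01 E1.
have [h1 h2] := h E E1 w wE; have [h'1 h'2] := h' E E1 w wE.
have CE : 0 <= C * E ^+ k by rewrite mulr_ge0// exprn_ge0// ltW.
have CE' : 0 <= C' * E ^+ k' by rewrite mulr_ge0// exprn_ge0// ltW.
have CC : C * C' * E ^+ (k + k') = C * E ^+ k * (C' * E ^+ k') by rewrite exprD; ring.
split=> [|w' d w'E d0 ww'].
  rewrite normrM -mulrA CC; have := ler_pM (normr_ge0 _) (normr_ge0 _) h1 h'1.
  have := mulr_ge0 CE CE'; lra.
have a := h2 w' d w'E d0 ww'; have b := h'2 w' d w'E d0 ww'.
have [h'1' _] := h' E E1 w' w'E.
have -> : f w * g w - f w' * g w' = f w * (g w - g w') + (f w - f w') * g w' by ring.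
apply: le_trans (ler_normD _ _) _; rewrite !normrM.
have := ler_pM (normr_ge0 _) (normr_ge0 _) h1 b.
have := ler_pM (normr_ge0 _) (normr_ge0 _) a h'1'.
rewrite -[2 * _ * _]mulrA CC; lra.
Qed.

Lemma tameN f : tame f -> tame (fun w => - f w).
Proof.
move=> tf; apply: tame_ext (tameM (tame_cst (-1)) tf) => w _.
by rewrite mulN1r.
Qed.

Lemma tame_sum (I : finType) (F : I -> 'rV[R]_m -> R) :
  (forall i, tame (F i)) -> tame (fun w => \sum_i F i w).
Proof.
move=> tF; have [s ->] : exists s, index_enum I = s by exists (index_enum I).
elim: s => [|i s IH].
  by apply: tame_ext (tame_cst 0) => w _; rewrite big_nil.
by apply: tame_ext (tameD (tF i) IH) => w _; rewrite big_cons.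
Qed.

Lemma box_sum E w : 1 <= E -> box E w -> \sum_i w 0 i <= m%:R * E.
Proof.
move=> E1 wE; rewrite mulr_natl -[X in _ *+ X](card_ord m) -sumr_const.
by apply: ler_sum => i _; have /andP[] := wE i.
Qed.

(** The edge [i] bounds the sum below by 1/E on the box. A difference of inverses is s^-1 s'^-1 (s'
    - s), whence the exponent 2. *)
Lemma tame_inv_sum (i : 'I_m) : tame (fun w => (\sum_j w 0 j)^-1).
Proof.
exists (1 + m%:R), 2%N; split=> [|E E1 w wE]; first by rewrite addr_ge0.
have E0 := lt_le_trans ltr01 E1.
have S0 v : box E v -> 0 < \sum_j v 0 j /\ (\sum_j v 0 j)^-1 <= E.
  move=> vE; have v0 := box_pos E1 vE.
  have h : E^-1 <= \sum_j v 0 j.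
    have /andP[h _] := vE i; rewrite (bigD1 i)//= (le_trans h)// lerDl sumr_ge0// => j _.
    exact: ltW.
  have S0 : 0 < \sum_j v 0 j by rewrite (lt_le_trans _ h)// invr_gt0.
  by split=> //; rewrite -[leRHS]invrK lef_pV2 ?posrE// invr_gt0.
have [s0 sE] := S0 w wE; split=> [|w' d w'E d0 ww'].
  rewrite gtr0_norm ?invr_gt0//; apply: le_trans sE _.
  have : 0 <= m%:R :> R by [].
  by rewrite expr2; nra.
have [s'0 s'E] := S0 w' w'E.
have dist : `|\sum_j w 0 j - \sum_j w' 0 j| <= m%:R * d.
  rewrite -sumrB; apply: le_trans (ler_norm_sum _ _ _) _.
  rewrite mulr_natl -[X in _ *+ X](card_ord m) -sumr_const.
  by apply: ler_sum => j _.
set s := \sum_j w 0 j in s0 sE dist *; set s' := \sum_j w' 0 j in s'0 s'E dist *.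
have -> : s^-1 - s'^-1 = s^-1 * s'^-1 * (s' - s) by field; rewrite !gt_eqF.
rewrite normrM distrC ger0_norm; last by rewrite mulr_ge0 ?invr_ge0//; exact: ltW.
have a : s^-1 * s'^-1 <= E ^+ 2 by rewrite expr2; apply: ler_pM => //; rewrite invr_ge0; exact: ltW.
have a0 : 0 <= s^-1 * s'^-1 by rewrite mulr_ge0 ?invr_ge0//; apply: ltW.
apply: (@le_trans _ _ (E ^+ 2 * (m%:R * d))); first by apply: ler_pM.
have : 0 <= E ^+ 2 * d by rewrite mulr_ge0 ?exprn_ge0// ltW.
nra.
Qed.

(** Picard iteration needs one function L for all components. Summing constants and exponents is
    safe because E >= 1. *)
Lemma tame_family (I : finType) (F : I -> 'rV[R]_m -> R) : (forall i, tame (F i)) ->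
  exists C k, 0 <= C /\ forall E : R, 1 <= E -> forall w i, box E w ->
  `|F i w| <= C * E ^+ k /\ forall w' d, box E w' -> 0 < d ->
  (forall j, `|w 0 j - w' 0 j| <= d) -> `|F i w - F i w'| <= C * E ^+ k * d.
Proof.
move=> /choice[C /choice[k h]].
have C0 i : 0 <= C i by have [] := h i.
exists (\sum_i C i), (\sum_i k i)%N; split=> [|E E1 w i wE]; first exact: sumr_ge0.
have le : C i * E ^+ k i <= (\sum_i C i) * E ^+ (\sum_i k i).
  apply: ler_pM => //; first by rewrite exprn_ge0// (le_trans ler01).
    by rewrite (bigD1 i)//= lerDl sumr_ge0.
  by rewrite ler_weXn2l// (bigD1 i)//= leq_addr.
have [_ /(_ E E1 w wE)[h1 h2]] := h i; split; first exact: le_trans le.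
by move=> w' d w'E d0 ww'; apply: le_trans (h2 w' d w'E d0 ww') _; rewrite ler_wpM2r// ltW.
Qed.

(** Since w'_i >= 1/E, the additive error d is at most E d w'_i. *)
Lemma box_ratio E w w' d : 1 <= E -> box E w -> box E w' -> 0 < d ->
  (forall i, `|w 0 i - w' 0 i| <= d) -> forall i, w 0 i <= (1 + E * d) * w' 0 i.
Proof.
move=> E1 wE w'E d0 ww' i; have E0 := lt_le_trans ltr01 E1.
have := ww' i; rewrite ler_norml => /andP[_ h].
have /andP[h' _] := w'E i.
have : 1 <= E * w' 0 i by rewrite -ler_pdivrMl// mulr1.
nra.
Qed.

End Tame.

(** * The vector field of the flow: regularity and growth *)

Section FlowField.
Variables (R : realType) (V : finType) (m : nat) (G : graph V m).
Hypothesis Gconn : connected_graph G.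
Implicit Types (w : 'rV[R]_m) (u v : V).

Let pos_ge0 w : positive_weight w -> forall i, 0 <= w 0 i.
Proof. by move=> w0 i; exact: ltW. Qed.

Definition half_transport w i :=
  transport G w (mu G w 2^-1 (ends G i).1) (mu G w 2^-1 (ends G i).2).

Lemma mu_half_prob w i : positive_weight w ->
  is_prob (mu G w 2^-1 (ends G i).1) /\ is_prob (mu G w 2^-1 (ends G i).2).
Proof.
move=> w0; have a01 : 0 <= (2^-1 : R) <= 1 by apply/andP; split; lra.
split; last exact: mu_prob (adj_ends G i) a01.
by apply: (@mu_prob _ _ _ _ _ _ _ (ends G i).2) => //; rewrite adj_sym adj_ends.
Qed.

Lemma rho_gt0 w i : positive_weight w -> 0 < rho G w i.
Proof.
move=> w0; have [E [E1 wE _]] := positive_box w0.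
have E0 : 0 < E^-1 by rewrite invr_gt0 (lt_le_trans ltr01).
apply: lt_le_trans E0 _; apply: dist_ge_min => //; first exact: ends_neq.
  by rewrite invr_ge0 (le_trans ler01).
by move=> j; have /andP[] := wE j.
Qed.

Lemma kappa_rho w i : positive_weight w ->
  kappa G w i * rho G w i = 2 * (rho G w i - half_transport w i).
Proof.
move=> w0; have r0 := rho_gt0 i w0.
rewrite /kappa /curvature -/(rho G w i).
set c := 2 * (rho G w i - half_transport w i).
have half : 2^-1 <= (2^-1 : R) < 1 by apply/andP; split; lra.
rewrite (_ : lim _ = c / rho G w i) ?divfK ?gt_eqF//.
apply: lim_near_cst; first exact: Rhausdorff.
near=> a.
have a01 : 2^-1 <= a < 1.
  apply/andP; split; last by near: a; exact: nbhs_left_lt.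
  by near: a; apply: nbhs_left_ge; lra.
(* The inequality holds with the two idlenesses in either order, and its two instances give
   equality. *)
have := transport_idle Gconn w0 (adj_ends G i) half a01.
have := transport_idle Gconn w0 (adj_ends G i) a01 half.
have -> : (1 - 2^-1)^-1 = 2 :> R by field.
rewrite -/(half_transport w i) -/(rho G w i) -/c => h1 h2.
have /eqP <- : (1 - a)^-1 * (rho G w i - transport G w (mu G w a (ends G i).1)
  (mu G w a (ends G i).2)) == c by rewrite eq_le h1.
by field; rewrite gt_eqF//= subr_eq0; apply/eqP => e; move: a01; rewrite -e; lra.
Unshelve. all: by end_near. Qed.

Lemma box_dist_le E w u v : 1 <= E -> box E w -> dist G w u v <= #|V|%:R * m%:R * E.
Proof.
move=> E1 wE; apply: le_trans (dist_le Gconn u v (pos_ge0 (box_pos E1 wE))) _.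
by rewrite -mulrA ler_wpM2l// box_sum.
Qed.

Lemma tame_rho i : tame (fun w => rho G w i).
Proof.
exists (#|V|%:R * m%:R), 2%N; split=> [|E E1 w wE]; first exact: mulr_ge0.
have E0 := lt_le_trans ltr01 E1.
have w0 := pos_ge0 (box_pos E1 wE).
have K0 : 0 <= #|V|%:R * m%:R :> R by exact: mulr_ge0.
have wD := box_dist_le (ends G i).1 (ends G i).2 E1 wE; split=> [|w' d w'E d0 ww'].
  rewrite ger0_norm ?dist_ge0//; apply: le_trans wD _; rewrite ler_wpM2l//.
  by rewrite expr2 ler_peMl// ltW.
have w'0 := pos_ge0 (box_pos E1 w'E).
have w'D := box_dist_le (ends G i).1 (ends G i).2 E1 w'E.
have w'w j : `|w' 0 j - w 0 j| <= d by rewrite distrC.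
have e0 : 0 < 1 + E * d by rewrite addr_gt0// mulr_gt0.
have h1 := dist_scale Gconn (ends G i).1 (ends G i).2 e0 w0 (box_ratio E1 wE w'E d0 ww').
have h2 := dist_scale Gconn (ends G i).1 (ends G i).2 e0 w'0 (box_ratio E1 w'E wE d0 w'w).
have Ed : 0 <= E * d by rewrite mulr_ge0 ?ltW.
move: (ler_wpM2l Ed wD) (ler_wpM2l Ed w'D) h1 h2; rewrite -!/(rho _ _ _).
have -> : E * d * (#|V|%:R * m%:R * E) = #|V|%:R * m%:R * E ^+ 2 * d by ring.
move=> ? ? ? ?; rewrite ler_norml; apply/andP; split; lra.
Qed.

(** [transport_perturb] is applied with c = 1 + e, e = E d, and th = c^-2: the measures lose at most
    c^2, the distances c, and th c = 1/c <= 1. The leftover mass 1 - th <= 2 e travels at most |V| m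
    E. *)
Lemma tame_half_transport i : tame (fun w => half_transport w i).
Proof.
exists (2 * (#|V|%:R * m%:R)), 2%N; split=> [|E E1 w wE]; first by rewrite !mulr_ge0.
have E0 := lt_le_trans ltr01 E1.
have K0 : 0 <= #|V|%:R * m%:R :> R by exact: mulr_ge0.
have D0 : 0 <= #|V|%:R * m%:R * E by rewrite mulr_ge0// ltW.
have w0 := box_pos E1 wE; have [p1 p2] := mu_half_prob i w0.
split=> [|w' d w'E d0 ww'].
  rewrite ger0_norm; last exact: transport_ge0 (pos_ge0 w0) p1 p2.
  apply: (@le_trans _ _ (#|V|%:R * m%:R * E)).
    by apply: transport_le (pos_ge0 w0) p1 p2 _ => // u v; exact: box_dist_le.
  rewrite expr2; have : #|V|%:R * m%:R * E <= #|V|%:R * m%:R * E * E by rewrite ler_peMr.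
  lra.
suff key (v v' : 'rV[R]_m) : box E v -> box E v' -> (forall j, `|v 0 j - v' 0 j| <= d) ->
    half_transport v' i <= half_transport v i + 2 * (#|V|%:R * m%:R) * E ^+ 2 * d.
  have w'w j : `|w' 0 j - w 0 j| <= d by rewrite distrC.
  have := key w w' wE w'E ww'; have := key w' w w'E wE w'w.
  by move=> ? ?; rewrite ler_norml; apply/andP; split; lra.
move=> vE v'E vv'.
have v0 := box_pos E1 vE; have v'0 := box_pos E1 v'E.
have [q1 q2] := mu_half_prob i v0; have [q'1 q'2] := mu_half_prob i v'0.
have v'v j : `|v' 0 j - v 0 j| <= d by rewrite distrC.
have r1 := box_ratio E1 vE v'E d0 vv'; have r2 := box_ratio E1 v'E vE d0 v'v.
have Ed : 0 < E * d by rewrite mulr_gt0.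
set e := E * d in r1 r2 Ed.
have c0 : 0 < 1 + e by lra.
have half : 0 <= (2^-1 : R) <= 1 by apply/andP; split; lra.
(* Equivalently (1 - 2 e) (1 + e)^2 = 1 - 3 e^2 - 2 e^3 <= 1. *)
have th1 : 1 - (1 + e) ^- 2 <= 2 * e.
  rewrite lerBlDr -lerBlDl -[leRHS]mul1r ler_pdivlMr ?exprn_gt0//.
  have := mulr_gt0 Ed Ed; have := mulr_gt0 Ed (mulr_gt0 Ed Ed).
  by rewrite expr2; nra.
apply: le_trans (@transport_perturb _ _ _ _ Gconn v v' _ _ _ _ ((1 + e) ^- 2) (1 + e)
  (#|V|%:R * m%:R * E) (pos_ge0 v'0) q1 q2 q'1 q'2 _ c0 _ _ _ _ (pos_ge0 v0) _) _.
- rewrite invr_gt0 exprn_gt0//= invf_lt1 ?exprn_gt0// expr2.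
  by have := mulr_gt0 Ed Ed; nra.
- by rewrite expr2 invfM divfK ?gt_eqF// invf_le1//; lra.
- by move=> u; apply: mu_scale => //; lra.
- by move=> u; apply: mu_scale => //; lra.
- move=> u x; apply: dist_scale => //; exact: pos_ge0.
- by move=> u x; exact: box_dist_le.
- rewrite lerD2l; apply: le_trans (ler_wpM2r D0 th1) _.
  by rewrite /e le_eqVlt; apply/orP; left; apply/eqP; ring.
Qed.

Lemma tame_flow i : tame (fun w => flow_rhs G w i).
Proof.
have tk j : tame (fun w => kappa G w j * rho G w j).
  have t := tameM (tame_cst _ 2) (tameD (tame_rho j) (tameN (tame_half_transport j))).
  by apply: tame_ext t => w w0; rewrite kappa_rho.
have t := tameD (tameN (tk i)) (tameM (tameM (tame_sum tk) (tame_inv_sum R i)) (tame_rho i)).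
by apply: tame_ext t => w _; rewrite /flow_rhs mulNr.
Qed.

Lemma kappa_rho_le w i : positive_weight w -> kappa G w i * rho G w i <= 2 * rho G w i.
Proof.
move=> w0; rewrite kappa_rho//; have [p1 p2] := mu_half_prob i w0.
have := transport_ge0 Gconn (pos_ge0 w0) p1 p2; rewrite -/(half_transport w i); lra.
Qed.

Lemma kappa_rho_ge w i : positive_weight w ->
  - (2 * #|V|%:R * \sum_j w 0 j) <= kappa G w i * rho G w i.
Proof.
move=> w0; rewrite kappa_rho//; have [p1 p2] := mu_half_prob i w0.
have := transport_le Gconn (pos_ge0 w0) p1 p2 (fun u v => dist_le Gconn u v (pos_ge0 w0)).
have := rho_gt0 i w0; rewrite -/(half_transport w i); lra.
Qed.

(** A common rate for both walls of the box: decay needs 2 (1 + |V| m), and growth needs 2 (1 + |V|)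
    m once the total weight is bounded by m times the largest one. *)
Definition flow_rate : R := 2 * (1 + #|V|%:R) * (1 + m%:R).

Lemma flow_bounds w i : positive_weight w ->
  - (flow_rate * w 0 i) <= flow_rhs G w i <= 2 * (1 + #|V|%:R) * \sum_j w 0 j.
Proof.
move=> w0; have wi := dist_le_weight G i (pos_ge0 w0); have r0 := rho_gt0 i w0.
have s0 : 0 < \sum_j w 0 j.
  by rewrite (bigD1 i)//= ltr_pwDl ?w0// sumr_ge0// => j _; exact: pos_ge0.
have wis : w 0 i <= \sum_j w 0 j.
  by rewrite (bigD1 i)//= lerDl sumr_ge0// => j _; exact: pos_ge0.
have ku : (\sum_j kappa G w j * rho G w j) / (\sum_j w 0 j) <= 2.
  rewrite ler_pdivrMr// mulr_sumr; apply: ler_sum => j _.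
  apply: le_trans (kappa_rho_le j w0) _; rewrite ler_wpM2l//.
  exact: dist_le_weight (pos_ge0 w0).
have kl : - (2 * #|V|%:R * m%:R) <= (\sum_j kappa G w j * rho G w j) / (\sum_j w 0 j).
  rewrite ler_pdivlMr// [leLHS](_ : _ = \sum_(j < m) - (2 * #|V|%:R * \sum_j w 0 j)).
    by apply: ler_sum => j _; exact: kappa_rho_ge.
  by rewrite sumr_const card_ord -mulr_natr; ring.
rewrite /flow_rhs /flow_rate.
rewrite mulNr; move: (kappa_rho_le i w0) (kappa_rho_ge i w0) ku kl wi r0 wis s0 (w0 i).
move: ((\sum_j kappa G w j * rho G w j) / \sum_j w 0 j) => q.
move: (kappa G w i * rho G w i) => k; move: (rho G w i) (\sum_j w 0 j) => r s.
move=> k1 k2 q1 q2 wi r0 wis s0 wi0.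
have K0 : 0 <= #|V|%:R :> R by [].
have M0 : 0 <= m%:R :> R by [].
have qr1 : q * r <= 2 * r by rewrite ler_wpM2r// ltW.
have qr2 : - (2 * #|V|%:R * m%:R) * r <= q * r by rewrite ler_wpM2r// ltW.
have KM : 0 <= #|V|%:R * m%:R :> R by exact: mulr_ge0.
apply/andP; split; last lra.
have : #|V|%:R * m%:R * r <= #|V|%:R * m%:R * w 0 i by exact: ler_wpM2l.
have := mulr_ge0 K0 (ltW wi0); have := mulr_ge0 M0 (ltW wi0); lra.
Qed.

End FlowField.

(** * Existence and uniqueness *)

Section OneSidedDerivative.
Variable R : realType.
Implicit Types f : R -> R.

Lemma has_deriv_inP (D : set R) f (t l : R) : has_deriv_in D f t l <->
  forall e, 0 < e -> exists2 d, 0 < d &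
    forall s, D s -> s != t -> `|s - t| < d -> `|l - (f s - f t) / (s - t)| <= e.
Proof.
split=> [/cvgrPdist_le h e e0|h].
  have /nbhs_ballP[d /= d0 hd] := h e e0.
  by exists d => // s Ds st sd; apply: (hd s _ st Ds); rewrite /ball/= distrC.
apply/cvgrPdist_le => e e0; have [d d0 hd] := h e e0.
apply/nbhs_ballP; exists d => //= s; rewrite /ball/= distrC => sd st Ds.
exact: hd.
Qed.

Lemma is_derive_has_deriv_in (D : set R) f (t l : R) :
  is_derive t 1 f l -> has_deriv_in D f t l.
Proof.
move=> [dv <-]; apply/has_deriv_inP => e e0.
have /cvgrPdist_le/(_ e e0)/nbhs_ballP[d /= d0 hd] := dv.
exists d => // s _ st sd; have := hd (s - t).
rewrite /ball/= sub0r normrN subr_eq0 => /(_ sd st).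
by rewrite /GRing.scale/= mulr1 subrK [_^-1 * _]mulrC.
Qed.

Lemma has_deriv_in_is_derive f (t l : R) : 0 < t ->
  has_deriv_in [set s : R | 0 <= s] f t l -> is_derive t 1 f l.
Proof.
move=> t0 /has_deriv_inP h.
have c : h^-1 *: ((f \o shift t) (h *: 1) - f t) @[h --> 0^'] --> l.
  apply/cvgrPdist_le => e e0; have [d d0 hd] := h e e0.
  (* The minimum with t keeps t + k in the half-line where the quotient is controlled. *)
  have dt0 : 0 < Num.min d t by rewrite lt_min d0.
  apply/nbhs_ballP; exists (Num.min d t) => //= k; rewrite /ball/= sub0r normrN.
  rewrite lt_min => /andP[kd kt] k0; have := hd (k + t).
  rewrite addrK -subr_eq0 addrK /GRing.scale/= mulr1 [_^-1 * _]mulrC; apply => //.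
  by move: kt; rewrite ltr_norml => /andP[]; lra.
by apply: DeriveDef; [apply/cvg_ex; exists l|exact/cvg_lim].
Qed.

Lemma has_deriv_in_continuous f (f' : R -> R) :
  (forall t : R, 0 <= t -> has_deriv_in [set s : R | 0 <= s] f t (f' t)) ->
  continuous (fun t : R => f (Num.max t 0)).
Proof.
move=> df t; apply/cvgrPdist_le => e e0.
have a0 : 0 <= Num.max t 0 by rewrite le_max lexx orbT.
have /has_deriv_inP/(_ 1 ltr01)[d d0 hd] := df _ a0.
set a := Num.max t 0 in a0 hd *.
have M0 : 0 < `|f' a| + 1 by rewrite ltr_wpDl.
pose d' := Num.min d (e / (`|f' a| + 1)).
have d'0 : 0 < d' by rewrite lt_min d0 divr_gt0.
apply/nbhs_ballP; exists d' => //= s; rewrite /ball/= distrC => st.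
have b0 : 0 <= Num.max s 0 by rewrite le_max lexx orbT.
(* Truncation at 0 does not increase distances. *)
have ba : `|Num.max s 0 - a| < d'.
  apply: le_lt_trans st; rewrite /a; case: (leP s 0); case: (leP t 0) => ? ?.
  - by rewrite subrr normr0.
  - by rewrite ler_norml; apply/andP; split; have := ler_norm (t - s); rewrite distrC; lra.
  - by rewrite ler_norml; apply/andP; split; have := ler_norm (s - t); lra.
  - by [].
have [->|bNa] := eqVneq (Num.max s 0) a; first by rewrite subrr normr0 ltW.
have [bd be] : `|Num.max s 0 - a| < d /\ `|Num.max s 0 - a| < e / (`|f' a| + 1).
  by apply/andP; rewrite -lt_min.
have q := hd _ b0 bNa bd.
have ba0 : 0 < `|Num.max s 0 - a| by rewrite normr_gt0 subr_eq0.
rewrite distrC -[f _ - f a](@divfK _ (Num.max s 0 - a)) ?subr_eq0// normrM.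
apply: (@le_trans _ _ ((`|f' a| + 1) * `|Num.max s 0 - a|)).
  rewrite ler_wpM2r//; move: q; set Q := (_ / _) => q.
  have -> : Q = f' a - (f' a - Q) by ring.
  by apply: le_trans (ler_normB _ _) _; rewrite lerD2l.
by rewrite mulrC -ler_pdivlMr// ltW.
Qed.

Lemma has_deriv_in_derives_to f (f' : R -> R) :
  (forall t : R, 0 <= t -> has_deriv_in [set s : R | 0 <= s] f t (f' t)) ->
  derives_to (fun t : R => f (Num.max t 0)) (fun t : R => f' (Num.max t 0)).
Proof.
move=> df; split=> [|t t0]; first exact: has_deriv_in_continuous df.
rewrite max_l ?(ltW t0)//.
apply: (@near_eq_is_derive _ _ _ f); last exact: has_deriv_in_is_derive t0 (df t (ltW t0)).
near=> s; rewrite max_l//; apply: ltW; near: s; apply: cvgr_gt; [exact: cvg_id|exact: t0].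
Unshelve. all: by end_near. Qed.

End OneSidedDerivative.

(** * Clamping a weight to a box *)

Section Clamp.
Variables (R : realType) (m : nat).
Implicit Types w : 'rV[R]_m.

Definition clamp (E : R) w : 'rV[R]_m := \row_i Num.max E^-1 (Num.min (w 0 i) E).

Lemma clamp_box E w : 1 <= E -> box E (clamp E w).
Proof.
move=> E1 i; rewrite mxE le_max lexx /= ge_max ge_min lexx orbT andbT.
by rewrite (le_trans _ E1)// invf_le1// (lt_le_trans ltr01).
Qed.

Lemma clamp_id E w : box E w -> clamp E w = w.
Proof.
move=> wE; apply/rowP => i; rewrite mxE; have /andP[h1 h2] := wE i.
by rewrite min_l// max_r.
Qed.

Lemma clamp_dist E w w' d : (forall i, `|w 0 i - w' 0 i| <= d) ->
  forall i, `|clamp E w 0 i - clamp E w' 0 i| <= d.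
Proof.
move=> ww' i; apply: le_trans (ww' i); rewrite !mxE.
have maxD (a b c : R) : `|Num.max c a - Num.max c b| <= `|a - b|.
  have := ler_norm (a - b); have := ler_norm (b - a); have := normr_ge0 (a - b).
  rewrite [`|b - a|]distrC ler_norml; case: (leP c a); case: (leP c b) => ? ? ? ? ?;
    apply/andP; split; lra.
have minD (a b c : R) : `|Num.min a c - Num.min b c| <= `|a - b|.
  have := ler_norm (a - b); have := ler_norm (b - a); have := normr_ge0 (a - b).
  rewrite [`|b - a|]distrC ler_norml; case: (leP a c); case: (leP b c) => ? ? ? ? ?;
    apply/andP; split; lra.
exact: le_trans (maxD _ _ _) (minD _ _ _).
Qed.

Lemma clamp_continuous (E : R -> R) (x : R -> 'rV[R]_m) : continuous E ->
  (forall t, 1 <= E t) -> (forall i, continuous (fun t => x t 0 i)) ->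
  forall i, continuous (fun t => clamp (E t) (x t) 0 i).
Proof.
move=> cE E1 cx i.
have -> : (fun t => clamp (E t) (x t) 0 i) =
    (fun t => (E t)^-1) \max ((fun t => x t 0 i) \min E).
  by apply/funext => t; rewrite mxE.
move=> t; apply: continuous_max.
  by apply: cvgV; [rewrite gt_eqF// (lt_le_trans ltr01)|exact: cE].
by apply: continuous_min; [exact: cx|exact: cE].
Qed.

Lemma tame_continuous (f : 'rV[R]_m -> R) (E : R -> R) (y : R -> 'rV[R]_m) :
  tame f -> continuous E -> (forall t, 1 <= E t) -> (forall t, box (E t) (y t)) ->
  (forall i, continuous (fun t => y t 0 i)) -> continuous (fun t => f (y t)).
Proof.
move=> [C [k [C0 h]]] cE E1 yE cy t; apply/cvgrPdist_le => e e0.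
(* For s near t both points lie in the single box of size E t + 1, where one Lipschitz constant
   applies. *)
have E2 : 1 <= E t + 1 by rewrite (le_trans (E1 t))// lerDl.
have boxS s : E s <= E t + 1 -> box (E t + 1) (y s).
  move=> Es i; have /andP[a b] := yE s i; rewrite (le_trans b)// andbT.
  apply: le_trans a; rewrite lef_pV2// posrE; first exact: lt_le_trans E2.
  exact: lt_le_trans (E1 s).
have K0 : 0 <= C * (E t + 1) ^+ k.
  by rewrite mulr_ge0// exprn_ge0// (le_trans ler01).
pose d := e / (C * (E t + 1) ^+ k + 1).
have d0 : 0 < d by rewrite divr_gt0// ltr_wpDl.
have Et : E t <= E t + 1 by rewrite lerDl.
have [_ h2] := h _ E2 _ (boxS t Et).
have {h2}key s : E s <= E t + 1 -> (forall i, `|y t 0 i - y s 0 i| <= d) ->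
    `|f (y t) - f (y s)| <= e.
  move=> /boxS Es ys; apply: le_trans (h2 _ d Es d0 ys) _.
  rewrite /d mulrCA; apply: ler_piMr; first exact: ltW.
  by rewrite ler_pdivrMr ?mul1r ?lerDl// ltr_wpDl.
near=> s; apply: key.
  by apply: ltW; near: s; apply: cvgr_lt; [exact: cE|rewrite ltrDl].
by near: s; apply: filter_forall => i; move/cvgrPdist_le: (cy i t) => /(_ d d0).
Unshelve. all: by end_near. Qed.

End Clamp.

(** * Confinement of solutions to the growing box *)

Section FlowConfinement.
Variables (R : realType) (V : finType) (m : nat) (G : graph V m).
Hypothesis Gconn : connected_graph G.
Implicit Types (w : 'rV[R]_m) (y z : R -> 'rV[R]_m) (E : R).

Let b : R := flow_rate R V m.

Let b_ge0 : 0 <= b.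
Proof. by rewrite /b /flow_rate !mulr_ge0. Qed.

Definition envelope E (t : R) := E * expR (b * t).

Let derives_to_scaled_exp (a c : R) :
  derives_to (fun t => a * expR (c * t)) (fun t => c * (a * expR (c * t))).
Proof.
have h := derives_to_exp (derives_toM (derives_to_cst c) (@derives_to_id R)).
apply: derives_to_ext (derives_toM (derives_to_cst a) h) _ => t _; ring.
Qed.

Lemma envelope_ge1 E t : 1 <= E -> 0 <= t -> 1 <= envelope E t.
Proof.
move=> E1 t0; rewrite /envelope -[1]mulr1 ler_pM// -expR0 ler_expR.
exact: mulr_ge0.
Qed.

Lemma envelopeV E t : (envelope E t)^-1 = E^-1 * expR (- b * t).
Proof. by rewrite /envelope invfM mulNr expRN. Qed.

(** Outside a wall the clamped field is no faster than the wall. Below the lower one the clamped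
    coordinate is exactly 1/E(t), so F_i >= - b / E(t), the speed of that wall; at the upper one the
    clamped total weight is at most m E(t), so F_i <= b E(t). *)
Lemma clamped_flow_in_box z E : 1 <= E -> box E (z 0) ->
  (forall i, derives_to (fun t => z t 0 i)
     (fun t => flow_rhs G (clamp (envelope E t) (z t)) i)) ->
  forall t, 0 <= t -> box (envelope E t) (z t).
Proof.
move=> E1 zE dz t t0 i; have E0 := lt_le_trans ltr01 E1.
have [zl zu] : E^-1 <= z 0 0 i /\ z 0 0 i <= E by apply/andP.
apply/andP; split; rewrite -subr_le0.
- have d := derives_toD (derives_to_scaled_exp E^-1 (- b)) (derives_toN (dz i)).
  rewrite envelopeV; apply: (barrier d _ _ t0).
    by rewrite mulr0 expR0 mulr1 subr_le0.
  move=> u u0; rewrite -envelopeV subr_gt0 => zu'.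
  have e1 := envelope_ge1 E1 (ltW u0); set e := envelope E u in e1 zu' *.
  have /andP[h _] := flow_bounds Gconn i (box_pos e1 (clamp_box (z u) e1)).
  have cE : clamp e (z u) 0 i = e^-1.
    by rewrite mxE max_l// ge_min (ltW zu').
  by move: h; rewrite cE -/b; lra.
- have d := derives_toD (dz i) (derives_toN (derives_to_scaled_exp E b)).
  apply: (barrier d _ _ t0).
    by rewrite mulr0 expR0 mulr1 subr_le0.
  move=> u u0; rewrite -/(envelope E u) subr_gt0 => zu'.
  have e1 := envelope_ge1 E1 (ltW u0); set e := envelope E u in e1 zu' *.
  have eb := clamp_box (z u) e1.
  have /andP[_ h] := flow_bounds Gconn i (box_pos e1 eb).
  rewrite subr_le0; apply: le_trans h _; rewrite /b /flow_rate -[leRHS]mulrA.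
  rewrite ler_wpM2l ?mulr_ge0//; apply: le_trans (box_sum e1 eb) _.
  by rewrite ler_wpM2r ?lerDr// (le_trans ler01).
Qed.

(** Without the clamp F_i is bounded above only by the total weight, so the total is followed
    instead of each coordinate: y_i exp(b t) is nondecreasing and exp(- b t) sum y is nonincreasing.
    This is why E must dominate the initial total weight. *)
Lemma flow_in_box y E : (forall t, 0 <= t -> positive_weight (y t)) ->
  1 <= E -> box E (y 0) -> \sum_i y 0 0 i <= E ->
  (forall i, derives_to (fun t => y t 0 i) (fun t => flow_rhs G (y t) i)) ->
  forall t, 0 <= t -> box (envelope E t) (y t).
Proof.
move=> ypos E1 yE sE dy t t0 i; have E0 := lt_le_trans ltr01 E1.
apply/andP; split.
- have d := derives_toM (dy i) (derives_to_scaled_exp 1 b).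
  have := derives_to_ge d _ (lexx 0) t0; rewrite mulr0 expR0 !mulr1 mul1r.
  move=> h; rewrite envelopeV mulNr expRN ler_pdivrMr ?expR_gt0//.
  apply: le_trans (h _); first by have /andP[] := yE i.
  move=> u u0; rewrite mul1r.
  have /andP[k _] := flow_bounds Gconn i (ypos u (ltW u0)).
  have -> : y u 0 i * (b * expR (b * u)) + expR (b * u) * flow_rhs G (y u) i =
    expR (b * u) * (b * y u 0 i + flow_rhs G (y u) i) by ring.
  by rewrite mulr_ge0 ?expR_ge0//; move: k; rewrite -/b; lra.
- have d := derives_toN (derives_toM (derives_to_sum dy) (derives_to_scaled_exp 1 (- b))).
  have := derives_to_ge d _ (lexx 0) t0; rewrite mulr0 expR0 !mulr1 mul1r => h.
  apply: (@le_trans _ _ (\sum_j y t 0 j)).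
    by rewrite (bigD1 i)//= lerDl sumr_ge0// => j _; exact/ltW/ypos.
  rewrite /envelope -ler_pdivrMr ?expR_gt0// -expRN -mulNr; apply: le_trans sE.
  rewrite -lerN2; apply: h => u u0; rewrite mul1r oppr_ge0.
  set s := \sum_j y u 0 j.
  have -> : s * (- b * expR (- b * u)) + expR (- b * u) * (\sum_j flow_rhs G (y u) j) =
    expR (- b * u) * (\sum_j flow_rhs G (y u) j - b * s) by ring.
  rewrite mulr_ge0_le0 ?expR_ge0// subr_le0.
  have s0 : 0 <= s by apply: sumr_ge0 => j _; exact/ltW/(ypos u (ltW u0)).
  apply: (@le_trans _ _ (m%:R * (2 * (1 + #|V|%:R) * s))).
    rewrite mulr_natl -[X in _ *+ X](card_ord m) -sumr_const; apply: ler_sum => j _.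
    by have /andP[] := flow_bounds Gconn j (ypos u (ltW u0)).
  rewrite /b /flow_rate mulrCA -!mulrA ler_wpM2l// ler_wpM2l ?addr_ge0//.
  by rewrite ler_wpM2r// lerDr.
Qed.

End FlowConfinement.

Theorem theorem1p2 (R : realType) (V : finType) (m : nat) (G : graph V m)
    (w0 : 'rV[R]_m) :
  connected_graph G -> positive_weight w0 ->
  exists w : R -> 'rV[R]_m,
    flow_solution G [set t : R | 0 <= t] w0 w /\
    forall w' : R -> 'rV[R]_m,
      flow_solution G [set t : R | 0 <= t] w0 w' ->
      forall t : R, 0 <= t -> w' t = w t.
Proof.
move=> Gconn w0pos; have [E0 [E01 w0E sE]] := positive_box w0pos.
(* The absolute value keeps [E] continuous and at least 1 at negative times too, where the clamped
   field must still be continuous. *)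
pose E (t : R) := envelope V m E0 `|t|.
have E1 t : 1 <= E t by exact: envelope_ge1.
have cE : continuous E.
  move=> t; apply: cvgM; first exact: cvg_cst.
  apply: (@continuous_comp _ _ _ (fun t : R => flow_rate R V m * `|t|) expR).
    by apply: cvgM; [exact: cvg_cst|exact: norm_continuous].
  exact: continuous_expR.
have [C [k [C0 tameF]]] := tame_family (tame_flow R Gconn).
pose field (t : R) x i := flow_rhs G (clamp (E t) x) i.
pose L t := C * E t ^+ k.
have cL : continuous L.
  move=> t; apply: cvgM; first exact: cvg_cst.
  by apply: (@continuous_comp _ _ _ E (fun x : R => x ^+ k)); [exact: cE|exact: exprn_continuous].
have L0 t : 0 <= t -> 0 <= L t.
  by move=> _; rewrite mulr_ge0// exprn_ge0// (le_trans ler01).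
have bounded (t : R) (x : 'rV[R]_m) i : 0 <= t -> `|field t x i| <= L t.
  by move=> _; have [] := tameF _ (E1 t) _ i (clamp_box x (E1 t)).
have lip (t : R) (x y : 'rV[R]_m) (d : R) : 0 <= t -> 0 < d ->
    (forall i, `|x 0 i - y 0 i| <= d) -> forall i, `|field t x i - field t y i| <= L t * d.
  move=> _ d0 xy i; have [_] := tameF _ (E1 t) _ i (clamp_box x (E1 t)).
  apply=> //; first exact: clamp_box.
  exact: clamp_dist.
have cfield (x : R -> 'rV[R]_m) : (forall i, continuous (fun t => x t 0 i)) ->
    forall i, continuous (fun t => field t (x t) i).
  move=> cx i; apply: (tame_continuous (tame_flow R Gconn i) cE E1) => [t|].
    exact: clamp_box.
  exact: clamp_continuous.
have [z [cz z0 dz]] := picard_exists cL L0 bounded lip cfield w0.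
have Et t : 0 <= t -> E t = envelope V m E0 t by move=> t0; rewrite /E ger0_norm.
have zfield i : derives_to (fun t => z t 0 i) (fun t => field t (z t) i).
  by split=> // t /ltW; exact: dz.
have zbox t : 0 <= t -> box (E t) (z t).
  move=> t0; rewrite Et//; apply: (clamped_flow_in_box Gconn E01) t0; first by rewrite z0.
  move=> i; apply: derives_to_ext (zfield i) _ => s s0.
  by rewrite /field Et// ltW.
exists z; split.
  split=> // t t0; first by apply: box_pos (zbox t t0).
  move=> i; apply: is_derive_has_deriv_in.
  by have := dz i t t0; rewrite /field clamp_id//; exact: zbox.
move=> w' [w'pos w'd w'0] t t0.
(* Nothing is known of [w'] at negative times, so it is replaced there by its value at 0. *)
pose y t := w' (Num.max t 0).
have yw' s : 0 <= s -> y s = w' s by move=> s0; rewrite /y max_l.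
have dy i : derives_to (fun t => y t 0 i) (fun t => flow_rhs G (y t) i).
  exact: (has_deriv_in_derives_to (fun t t0 => w'd t t0 i)).
have y0 : y 0 = w0 by rewrite yw'.
have ybox s : 0 <= s -> box (E s) (y s).
  move=> s0; rewrite Et//; apply: (flow_in_box Gconn _ E01) s0; rewrite ?y0//.
  by move=> r r0; rewrite yw'//; exact: w'pos.
have yfield i : derives_to (fun t => y t 0 i) (fun t => field t (y t) i).
  apply: derives_to_ext (dy i) _ => s /ltW s0.
  by rewrite /field clamp_id//; exact: ybox.
rewrite -yw'//; apply: (picard_unique cL L0 bounded lip yfield zfield) t0.
by rewrite y0 z0.
Qed.
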